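(* Let $(M,g)$ be a connected semi-Riemannian manifold and let $I$ be an open interval. Let $\Sigma$ be a Lie group acting by isometries on $M$ and let $\pi:M\to I$ be a submersion such that the fibers of $\pi$ are orbits of the action. Assume that the gradient $\nabla\pi$ is nowhere lightlike. Then there exist $\widetilde\varepsilon\in\{1,-1\}$ and a map $v:I\to(\mathbb{R},\widetilde\varepsilon\,ds^2)$ such that $v\circ\pi$ is a semi-Riemannian submersion with constant mean curvature fibers.
   Context: Submersions $\pi:M\to I$ are smooth and surjective; $\nabla\pi$ is the $g$-gradient of $\pi$ regarded as a real function, and lightlike means nonzero with $g(\nabla\pi,\nabla\pi)=0$. The map $v$ is smooth. That $v\circ\pi$ is a semi-Riemannian submersion (onto its image, an open interval with metric $\widetilde\varepsilon\,ds^2$) means that it is a submersion with nondegenerate fibers whose differential is a linear isometry from the orthogonal complement of its kernel onto the tangent space of $(\mathbb{R},\widetilde\varepsilon\,ds^2)$. Its fibers are hypersurfaces with unit normal $\nabla(v\circ\pi)$; they have constant mean curvature if, on each fiber, the mean curvature with respect to this normal, $\sum_i\varepsilon_i\,g(\nabla_{e_i}\nabla(v\circ\pi),e_i)$ for an orthonormal frame $(e_i)$ of the fiber with $g(e_i,e_i)=\varepsilon_i$, is constant (the constant may depend on the fiber). *)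

(* Defs.v *)
From HB Require Import structures.
From mathcomp Require Import all_boot all_order all_algebra.
From mathcomp Require Import all_classical all_reals all_analysis.

Set Implicit Arguments.
Unset Strict Implicit.
Unset Printing Implicit Defensive.

Import Order.TTheory GRing.Theory Num.Theory.
Import numFieldNormedType.Exports.

Local Open Scope classical_set_scope.
Local Open Scope ring_scope.

(* Meant for open U: then neither 'd f x nor 'D_u f x, for x in U, depends on
   the values of f outside U. *)
Fixpoint Ck (R : realType) (V W : normedModType R) (k : nat) (U : set V)
    (f : V -> W) : Prop :=
  if k is k'.+1 then
    (forall x, U x -> differentiable f x) /\ forall u, Ck k' U ('D_u f)
  else forall x, U x -> {for x, continuous f}.

Definition smooth_on (R : realType) (V W : normedModType R) (U : set V)
  (f : V -> W) : Prop := forall k, Ck k U f.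

(* The values of cmap outside cdom, and of cinv outside cmap @` cdom, are
   irrelevant. *)
Record chart (R : realType) (V : normedModType R) (M : topologicalType) :=
  Chart { cdom : set M; cmap : M -> V; cinv : V -> M }.

Definition is_chart (R : realType) (V : normedModType R) (M : topologicalType)
    (c : chart V M) : Prop :=
  [/\ open (cdom c),
      open (cmap c @` cdom c),
      forall p, cdom c p -> cinv c (cmap c p) = p,
      forall p, cdom c p -> {for p, continuous (cmap c)} &
      forall p, cdom c p -> {for cmap c p, continuous (cinv c)}].

Definition smooth_manifold (R : realType) (V : normedModType R)
    (M : topologicalType) (A : set (chart V M)) : Prop :=
  [/\ hausdorff_space M,
      second_countable (T := M),
      forall c, A c -> is_chart c,
      forall p, exists2 c, A c & cdom c p &
      forall c d, A c -> A d ->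
        smooth_on (cmap c @` (cdom c `&` cdom d)) (cmap d \o cinv c)].

Definition model_atlas (R : realType) (V : normedModType R) : set (chart V V) :=
  [set Chart setT id id].

Definition prod_chart (R : realType) (V W : normedModType R)
    (M N : topologicalType) (c : chart V M) (d : chart W N) :
    chart (V * W)%type (M * N)%type :=
  Chart (cdom c `*` cdom d) (fun z => (cmap c z.1, cmap d z.2))
    (fun z => (cinv c z.1, cinv d z.2)).

Definition prod_atlas (R : realType) (V W : normedModType R)
    (M N : topologicalType) (A : set (chart V M)) (B : set (chart W N)) :
    set (chart (V * W)%type (M * N)%type) :=
  [set e | exists c d, [/\ A c, B d & e = prod_chart c d]].

Definition smooth_map (R : realType) (V W : normedModType R)
    (M N : topologicalType) (A : set (chart V M)) (B : set (chart W N))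
    (f : M -> N) : Prop :=
  continuous f /\
  forall c d, A c -> B d ->
    smooth_on (cmap c @` (cdom c `&` f @^-1` cdom d)) (cmap d \o f \o cinv c).

(* No compatibility is imposed here: it is part of [lie_group]. *)
#[short(type="topologicalGroupCarrier")]
HB.structure Definition TopologicalGroupCarrier :=
  {G of Group G & Topological G}.

Definition lie_group (R : realType) (V : normedModType R)
    (G : topologicalGroupCarrier) (A : set (chart V G)) : Prop :=
  [/\ smooth_manifold A,
      smooth_map (prod_atlas A A) A (fun z : G * G => (z.1 * z.2)%g) &
      smooth_map A A (fun x : G => (x^-1)%g)].

Definition smooth_action (R : realType) (V W : normedModType R)
    (G : topologicalGroupCarrier) (M : topologicalType)
    (A : set (chart V G)) (B : set (chart W M)) (act : G -> M -> M) : Prop :=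
  [/\ forall p, act 1%g p = p,
      forall x y p, act (x * y)%g p = act x (act y p) &
      smooth_map (prod_atlas A B) B (fun z : G * M => act z.1 z.2)].

Section SemiRiemannian.
Context (R : realType) (m : nat) (M : topologicalType).
Local Notation chartM := (chart 'rV[R]_m M).

(* A tangent vector at p is represented, in a chart c of the atlas around p, by
   the row vector of its components.  A metric is given by its Gram matrices:
   g c p is the matrix of the scalar product at p in the chart c. *)
Implicit Types (A : set chartM) (c d : chartM) (p : M) (u w : 'rV[R]_m)
  (g : chartM -> M -> 'M[R]_m) (f : M -> R).

Definition gdot g c p u w : R := (u *m g c p *m w^T) 0 0.

Definition tangent_map c d (phi : M -> M) p u : 'rV[R]_m :=
  'd (cmap d \o phi \o cinv c) (cmap c p) u.

Definition dif c f p u : R := 'd (f \o cinv c) (cmap c p) u.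

(* The signature is locally constant, hence constant when M is connected, so it
   is not recorded. *)
Definition semi_riemannian A g : Prop :=
  [/\ forall c, A c -> smooth_on (cmap c @` cdom c) (g c \o cinv c),
      forall c p, A c -> cdom c p -> (g c p)^T = g c p,
      forall c p, A c -> cdom c p -> g c p \in unitmx &
      forall c d p, A c -> A d -> cdom c p -> cdom d p -> forall u w,
        gdot g c p u w =
        gdot g d p (tangent_map c d id p u) (tangent_map c d id p w)].

(* Meant for diffeomorphisms phi, such as those given by a smooth action. *)
Definition preserves_metric A g (phi : M -> M) : Prop :=
  forall c d p, A c -> A d -> cdom c p -> cdom d (phi p) -> forall u w,
    gdot g d (phi p) (tangent_map c d phi p u) (tangent_map c d phi p w) =
    gdot g c p u w.

Definition pderiv c (i : 'I_m) f p : R := dif c f p (delta_mx 0 i).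

Definition grad g c f p : 'rV[R]_m :=
  (\row_i pderiv c i f p) *m invmx (g c p).

Definition lightlike g c p u : Prop := u != 0 /\ gdot g c p u u = 0.

Definition christoffel g c p (k i j : 'I_m) : R :=
  2^-1 * \sum_l invmx (g c p) k l *
    (pderiv c i (fun q => g c q j l) p + pderiv c j (fun q => g c q i l) p
     - pderiv c l (fun q => g c q i j) p).

(* Levi-Civita derivative in the direction u of the vector field whose
   components in the chart c are given by Y. *)
Definition covariant_derivative g c (Y : M -> 'rV[R]_m) p u : 'rV[R]_m :=
  'd (Y \o cinv c) (cmap c p) u
  + \row_k \sum_i \sum_j christoffel g c p k i j * u 0 i * Y p 0 j.

Definition open_interval (I : set R) : Prop :=
  [/\ open I, is_interval I & I !=set0].

Definition submersion A (I : set R) f : Prop :=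
  [/\ smooth_map A (@model_atlas R R) f,
      range f = I &
      forall c p, A c -> cdom c p -> forall t, exists u, dif c f p u = t].

Definition ker_dif c f p : set 'rV[R]_m := [set u | dif c f p u = 0].

Definition orthogonal_complement g c p (K : set 'rV[R]_m) : set 'rV[R]_m :=
  [set u | forall w, K w -> gdot g c p u w = 0].

(* f is a semi-Riemannian submersion onto the interval f(M) with the metric
   eps ds^2; the tangent space of the fiber through p is the kernel of df. *)
Definition semi_riemannian_submersion A g (eps : R) f : Prop :=
  [/\ open_interval (range f),
      submersion A (range f) f &
      forall c p, A c -> cdom c p ->
        let K := ker_dif c f p in
        let H := orthogonal_complement g c p K in
        [/\ forall u, K u -> H u -> u = 0,
            forall u w, H u -> H w ->
              eps * (dif c f p u * dif c f p w) = gdot g c p u w &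
            forall t, exists2 u, H u & dif c f p u = t]].

Definition orthonormal_frame g c p (K : set 'rV[R]_m)
    (e : 'I_m.-1 -> 'rV[R]_m) : Prop :=
  [/\ forall i, K (e i),
      forall i, gdot g c p (e i) (e i) = 1 \/ gdot g c p (e i) (e i) = -1 &
      forall i j, i != j -> gdot g c p (e i) (e j) = 0].

(* The fibers of f are hypersurfaces: e is a frame of the tangent space of the
   fiber through p, and grad f is the normal. *)
Definition mean_curvature g c f p (e : 'I_m.-1 -> 'rV[R]_m) : R :=
  \sum_i gdot g c p (e i) (e i) *
    gdot g c p (covariant_derivative g c (grad g c f) p (e i)) (e i).

Definition constant_mean_curvature_fibers A g f : Prop :=
  forall t, exists h, forall p, f p = t -> forall c, A c -> cdom c p ->
    forall e, orthonormal_frame g c p (ker_dif c f p) e ->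
      mean_curvature g c f p e = h.

End SemiRiemannian.

(* Main.v *)
Require Import Defs.
From HB Require Import structures.
From mathcomp Require Import all_boot all_order all_algebra.
From mathcomp Require Import all_classical all_reals all_analysis.
From mathcomp Require Import ring lra.

(** The group permutes the points of each fiber transitively by isometries
    that preserve [pi], so it carries gradients of [pi]
    to gradients of [pi]; hence g(grad pi, grad pi) is constant on fibers and
    equals [mu \o pi] for a function [mu] on [I].  As grad pi is neither zero
    nor lightlike, [mu] has no zero on the interval [I] and therefore a
    constant sign [eps].  Any [v] with v' = 1 / sqrt (eps mu) normalizes the
    gradient: grad (v \o pi) = v' grad pi has square eps.  A function whose
    gradient has square eps = 1 or -1 is a semi-Riemannian submersion by linear
    algebra in each tangent space, since the gradient spans the orthogonal
    complement of the kernel of the differential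
    ([unit_gradient_submersion]).  The mean curvature of its fibers is
    preserved by the isometries of the action, and as these are transitive
    on each fiber, it is constant there ([unit_gradient_cmc]).

    Smoothness of [mu] uses no section of [pi].  Along a line in a chart,
    [pi] restricts to a function [phi] of one variable with nonzero derivative,
    and mu \o phi = l is smooth.  Then mu' \o phi = l' / phi' is of the same
    shape, so induction on the order of differentiability applies, and only
    the existence of a local inverse of [phi] is needed ([Ck_descend]).  [v]
    comes from the fundamental theorem of calculus ([antiderivative]).

    For the mean curvature, only the numbers g(nabla_X N, X) matter, where
    N is the normal.  On the diagonal two of the three terms of the Christoffel
    symbols cancel, which leaves half the Lie derivative of the metric,
    g(D_X N, X) + (D_N g)(X, X) / 2 ([gdot_covariant_derivative]).  In this
    form the invariance under an isometry comes from differentiating the two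
    identities that express the metric and the normal in one chart by those in
    the other; the second derivatives of the isometry cancel because they are
    symmetric ([half_lie_isometry], [derive_sym]).  Thus an isometry transports
    an orthonormal frame without changing the sum that defines the mean
    curvature, and that sum is independent of the frame because it is a
    trace minus the contribution of the normal ([hyperplane_frame_sum]). *)

Set Implicit Arguments.
Unset Strict Implicit.
Unset Printing Implicit Defensive.

Import Order.TTheory GRing.Theory Num.Theory.
Import numFieldNormedType.Exports.

Local Open Scope classical_set_scope.
Local Open Scope ring_scope.

(** * Calculus of C^k functions on open sets *)

Section germ.
Context (R : realType) (V W : normedModType R).
Implicit Types (f g : V -> W) (x : V).

Lemma near_eq_diff_expansion f g x : {near x, f =1 g} -> differentiable f x ->
  g \o shift x = cst (g x) + 'd f x +o_ 0 id.
Proof.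
move=> fg df; apply/eqaddoP => e e0.
have fgx := nbhs_singleton fg.
have /eqaddoP /(_ e e0) := diff_locally df.
have fg' : \forall h \near (0 : V), f (h + x) = g (h + x).
  by move: fg; rewrite (near_shift 0 x) /= subr0.
apply: filterS2 fg' => h fgh.
by rewrite /= !fctE /= -fgh -fgx.
Qed.

Lemma near_eq_differentiable f g x : {near x, f =1 g} ->
  differentiable f x -> differentiable g x.
Proof.
move=> fg df; apply/diff_locallyP.
have cf := diff_continuous df.
have H := near_eq_diff_expansion fg df.
by rewrite (diff_unique cf H).
Qed.

End germ.

Section Ck_general.
Context (R : realType) (V W : normedModType R).
Implicit Types (f g : V -> W) (U : set V).

Lemma near_open U f g x : open U -> U x -> {in U, f =1 g} -> {near x, f =1 g}.
Proof.
move=> oU Ux fg; have : nbhs x U by exact: open_nbhs_nbhs.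
by apply: filterS => y Uy; apply: fg; rewrite inE.
Qed.

Lemma Ck_ext k U f g : open U -> {in U, f =1 g} -> Ck k U f -> Ck k U g.
Proof.
move=> oU; elim: k f g => [|k IH] f g fg /=.
  move=> cf x Ux; have nfg := near_open oU Ux fg.
  rewrite /prop_for /continuous_at -(nbhs_singleton nfg).
  by apply: cvg_trans (cf x Ux); apply: near_eq_cvg; exact: nfg.
move=> [df Df]; split=> [x Ux|u].
  exact: near_eq_differentiable (near_open oU Ux fg) (df x Ux).
apply: IH (Df u) => x; rewrite inE => Ux.
exact/near_eq_derive/(near_open oU Ux fg).
Qed.

Lemma CkS k U f : Ck k.+1 U f -> Ck k U f.
Proof.
elim: k f => [|k IH] f.
  by move=> [df _] x Ux; exact/differentiable_continuous/df.
by move=> [df Df]; split=> // u; apply: IH; exact: Df.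
Qed.

(** The condition [Ck k U f] is a conjunction over the points of U, although
    each of its clauses depends on the germ of f; so smoothness of a function
    on I can be proved near one point at a time. *)
Lemma Ck_pointwise k U f : (forall x, U x -> Ck k [set x] f) -> Ck k U f.
Proof.
elim: k f => [|k IH] f Uf /=; first by move=> x Ux; exact: (Uf x Ux).
split=> [x Ux|u]; first by have [d _] := Uf x Ux; exact: d.
by apply: IH => x Ux; have [_ D] := Uf x Ux; exact: D.
Qed.

Lemma Ck_subset k U U' f : U `<=` U' -> Ck k U' f -> Ck k U f.
Proof.
move=> UU'; elim: k f => [|k IH] f /=; first by move=> cf x /UU'; exact: cf.
by move=> [df Df]; split=> [x /UU'|u]; [exact: df|exact/IH/Df].
Qed.

Lemma Ck_cst k U (a : W) : Ck k U (cst a).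
Proof.
elim: k a => [|k IH] a /=; first by move=> x _; exact: cst_continuous.
split=> [x _|u]; first exact: differentiable_cst.
rewrite (_ : 'D_u (cst a) = cst 0) //.
by apply/funext => x; rewrite derive_cst.
Qed.

Lemma CkD k U f g : open U -> Ck k U f -> Ck k U g -> Ck k U (f \+ g).
Proof.
move=> oU; elim: k f g => [|k IH] f g /=.
  by move=> cf cg x Ux; apply: cvgD; [exact: cf|exact: cg].
move=> [df Df] [dg Dg]; split=> [x Ux|u].
  by apply: differentiableD; [exact: df|exact: dg].
apply: Ck_ext (IH _ _ (Df u) (Dg u)) => // x; rewrite inE => Ux /=.
by rewrite deriveD //; apply: diff_derivable; [exact: df|exact: dg].
Qed.

Lemma Ck_sum (J : Type) (r : seq J) (P : pred J) k U (F : J -> V -> W) :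
  open U -> (forall j, P j -> Ck k U (F j)) ->
  Ck k U (fun x => \sum_(j <- r | P j) F j x).
Proof.
move=> oU CF; elim: r => [|j r IH].
  rewrite (_ : (fun _ => _) = cst 0); first exact: Ck_cst.
  by apply/funext => x; rewrite big_nil.
case: (boolP (P j)) => Pj.
  rewrite (_ : (fun _ => _) = F j \+ (fun x => \sum_(j <- r | P j) F j x)).
    by apply: CkD => //; exact: CF.
  by apply/funext => x; rewrite big_cons Pj.
rewrite (_ : (fun _ => _) = (fun x => \sum_(j <- r | P j) F j x)) //.
by apply/funext => x; rewrite big_cons (negbTE Pj).
Qed.

End Ck_general.

(** Linear maps on the line are multiplications; this turns ['D_u] into
    [u * 'D_1] and makes the chain rule a product. *)
Lemma linear_realE (R : realType) (L : {linear R -> R}) (t : R) :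
  L t = t * L 1.
Proof.
rewrite (_ : t * L 1 = t *: L 1) // -linearZ; congr (L _).
by rewrite /GRing.scale /= mulr1.
Qed.

Section Ck_real.
Context (R : realType) (V : normedModType R).
Implicit Types (f g : V -> R) (U : set V).

Lemma CkM k U f g : open U -> Ck k U f -> Ck k U g ->
  Ck k U (fun x => f x * g x).
Proof.
move=> oU; elim: k f g => [|k IH] f g.
  by move=> cf cg x Ux; apply: continuousM; [exact: cf|exact: cg].
move=> Cf Cg; have [df Df] := Cf; have [dg Dg] := Cg; split=> [x Ux|u].
  by apply: differentiableM; [exact: df|exact: dg].
have CDf := IH _ _ (Df u) (CkS Cg); have CDg := IH _ _ (CkS Cf) (Dg u).
apply: Ck_ext (CkD oU CDg CDf) => // x; rewrite inE => Ux /=.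
rewrite deriveM; [|exact/diff_derivable/df|exact/diff_derivable/dg].
by rewrite /GRing.scale /= (mulrC (g x)).
Qed.

Lemma Ck_prod (J : Type) (r : seq J) (P : pred J) k U (F : J -> V -> R) :
  open U -> (forall j, P j -> Ck k U (F j)) ->
  Ck k U (fun x => \prod_(j <- r | P j) F j x).
Proof.
move=> oU CF; elim: r => [|j r IH].
  rewrite (_ : (fun _ => _) = cst 1); first exact: Ck_cst.
  by apply/funext => x; rewrite big_nil.
case: (boolP (P j)) => Pj.
  rewrite (_ : (fun _ => _) = fun x => F j x * \prod_(j <- r | P j) F j x).
    by apply: CkM => //; exact: CF.
  by apply/funext => x; rewrite big_cons Pj.
rewrite (_ : (fun _ => _) = (fun x => \prod_(j <- r | P j) F j x)) //.
by apply/funext => x; rewrite big_cons (negbTE Pj).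
Qed.

Lemma CkV k U f : open U -> (forall x, U x -> f x != 0) -> Ck k U f ->
  Ck k U (fun x => (f x)^-1).
Proof.
move=> oU f0; elim: k => [|k IH].
  by move=> cf x Ux; apply: continuousV; [exact: f0|exact: cf].
move=> Cf; have [df Df] := Cf; split=> [x Ux|u].
  by apply: differentiableV; [exact: df|exact: f0].
have Cinv := IH (CkS Cf).
have C1 : Ck k U (fun x => - 1 * ((f x)^-1 * (f x)^-1) * 'D_u f x).
  have C2 := CkM oU (Ck_cst k U (- 1 : R)) (CkM oU Cinv Cinv).
  exact: CkM oU C2 (Df u).
apply: Ck_ext C1 => // x; rewrite inE => Ux.
rewrite (@deriveV _ _ f); [|exact: f0|exact/diff_derivable/df].
by rewrite /GRing.scale /= -exprVn expr2 mulN1r.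
Qed.

Lemma Ck_comp k (I : set R) (v : R -> R) U f : open U ->
  (forall x, U x -> I (f x)) -> Ck k I v -> Ck k U f -> Ck k U (v \o f).
Proof.
move=> oU fI; elim: k v f fI => [|k IH] v f fI.
  by move=> cv cf x Ux; apply: continuous_comp; [exact: cf|exact/cv/fI].
move=> Cv Cf; have [df Df] := Cf; have [dv Dv] := Cv; split=> [x Ux|u].
  by apply: differentiable_comp; [exact: df|exact/dv/fI].
have Cc := IH _ _ fI (Dv 1) (CkS Cf).
apply: Ck_ext (CkM oU (Df u) Cc) => // x; rewrite inE => Ux /=.
have dvx := dv _ (fI _ Ux).
rewrite (deriveE _ (differentiable_comp (df _ Ux) dvx)).
rewrite (diff_comp (df _ Ux) dvx).
rewrite (deriveE _ (df _ Ux)) (deriveE _ dvx).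
exact/esym/linear_realE.
Qed.

End Ck_real.

(** The derivative of the square root is the inverse of a multiple of the
    square root, so each order follows from the preceding one. *)
Lemma Ck_sqrt (R : realType) k : Ck k [set x : R | 0 < x] (@Num.sqrt R).
Proof.
have oP : open [set x : R | 0 < x] by exact: open_gt.
elim: k => [|k IH].
  by move=> x _; exact: sqrt_continuous.
split=> [x x0|u].
  apply/derivable1_diffP.
  by have [] := is_derive1_sqrt x0.
have : Ck k [set x : R | 0 < x] (fun x => u * (2 * Num.sqrt x)^-1).
  apply: CkM => //; first exact: Ck_cst.
  apply: CkV => //.
    by move=> x x0; rewrite mulf_neq0 // gt_eqF // sqrtr_gt0.
  by apply: CkM => //; exact: Ck_cst.
apply: Ck_ext => // x; rewrite inE => x0.
have [d <-] := is_derive1_sqrt x0.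
have ds : differentiable (@Num.sqrt R) x by apply/derivable1_diffP.
by rewrite !(deriveE _ ds) -linear_realE.
Qed.

(** * Matrix-valued functions and the symmetry of second derivatives *)

Section Ck_matrix.
Context (R : realType) (V : normedModType R) (U : set V).
Hypothesis oU : open U.

Lemma Ck_coord m n k (F : V -> 'M[R]_(m, n)) i j :
  Ck k U F -> Ck k U (fun x => F x i j).
Proof.
elim: k F => [|k IH] F.
  move=> cF x Ux.
  apply: (@continuous_comp _ _ _ F (fun M : 'M[R]_(m, n) => M i j)).
    exact: cF.
  exact: coord_continuous.
move=> [dF DF]; split=> [x Ux|u].
  apply: (@differentiable_comp _ _ _ _ F (fun M : 'M[R]_(m, n) => M i j)).
    exact: dF.
  exact: differentiable_coord.
apply: Ck_ext (IH _ (DF u)) => // x; rewrite inE => Ux.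
by rewrite derive_mx ?mxE //; exact/diff_derivable/dF.
Qed.

Lemma Ck_det n k (F : V -> 'M[R]_n) :
  (forall i j, Ck k U (fun x => F x i j)) -> Ck k U (fun x => \det (F x)).
Proof.
move=> CF; rewrite /determinant; apply: Ck_sum => // s _.
by apply: CkM => //; [exact: Ck_cst|apply: Ck_prod].
Qed.

(** Cramer's rule expresses the entries of the inverse as quotients of
    polynomials in the entries. *)
Lemma Ck_invmx n k (F : V -> 'M[R]_n) i j :
  (forall x, U x -> F x \in unitmx) ->
  (forall i j, Ck k U (fun x => F x i j)) ->
  Ck k U (fun x => invmx (F x) i j).
Proof.
move=> uF CF.
have C1 : Ck k U (fun x => (\det (F x))^-1 *
    ((-1) ^+ (j + i) * \det (row' j (col' i (F x))))).
  apply: CkM => //.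
    apply: CkV => //; last exact: Ck_det.
    by move=> x Ux; rewrite -unitfE -unitmxE; exact: uF.
  apply: CkM => //; first exact: Ck_cst.
  apply: Ck_det => a b; apply: Ck_ext (CF (lift j a) (lift i b)) => // x _.
  by rewrite !mxE.
apply: Ck_ext C1 => // x; rewrite inE => Ux.
by rewrite /invmx uF // !mxE.
Qed.

Lemma differentiable_mx m n (F : V -> 'M[R]_(m, n)) x :
  (forall i j, differentiable (fun y => F y i j) x) -> differentiable F x.
Proof.
move=> dF.
rewrite (_ : F = \sum_i \sum_j (fun y => F y i j *: delta_mx i j)).
  apply: differentiable_sum => i; apply: differentiable_sum => j.
  exact: differentiableZl.
apply/funext => y; rewrite fct_sumE [LHS]matrix_sum_delta.
by apply: eq_bigr => i _; rewrite fct_sumE.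
Qed.

End Ck_matrix.

(** A map that is smooth jointly in two variables gives, for each value of the
    first, a smooth map of the second: the derivative in the direction u of the
    slice is the slice of the derivative in the direction (0, u). *)
Lemma Ck_slice (R : realType) (V W X : normedModType R) k (U : set (V * W))
    (F : V * W -> X) (a : V) :
  Ck k U F -> Ck k [set y | U (a, y)] (fun y => F (a, y)).
Proof.
elim: k F => [|k IH] F.
  move=> cF y Uy; apply: (@continuous_comp _ _ _ (pair a) F); last exact: cF.
  by apply: cvg_pair => /=; [exact: cvg_cst|exact: cvg_id].
move=> [dF DF]; split=> [y Uy|u].
  apply: (@differentiable_comp _ _ _ _ (fun y => (a, y)) F); last exact: dF.
  have cd : differentiable (cst a : W -> V) y by exact: differentiable_cst.
  have di : differentiable (id : W -> W) y by apply: ex_diff.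
  exact: (differentiable_pair cd di).
rewrite (_ : 'D_u _ = fun y => 'D_(0, u) F (a, y)); first exact: IH (DF (0, u)).
apply/funext => y; rewrite /derive.
rewrite (_ : (fun h => _) = fun h : R =>
  h^-1 *: ((F \o shift (a, y)) (h *: (0, u)) - F (a, y))) //.
apply/funext => h /=; congr (_ *: (F _ - _)).
by rewrite [RHS](_ : _ = (h *: 0 + a, h *: u + y)) // scaler0 add0r.
Qed.

Section derivatives.
Context (R : realType) (V : normedModType R).

Lemma derive_chain (W X : normedModType R) (phi : V -> W) (F : W -> X) x v :
  differentiable phi x -> differentiable F (phi x) ->
  'D_v (F \o phi) x = 'D_('D_v phi x) F (phi x).
Proof.
move=> dphi dF; rewrite (deriveE _ (differentiable_comp dphi dF)).
by rewrite (diff_comp dphi dF) (deriveE _ dphi) (deriveE _ dF).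
Qed.

Lemma is_derive_mulmx m n p (A : V -> 'M[R]_(m, n)) (B : V -> 'M[R]_(n, p))
    x v : derivable A x v -> derivable B x v ->
  is_derive x v (fun y => A y *m B y) ('D_v A x *m B x + A x *m 'D_v B x).
Proof.
move=> dA dB.
have dAe i j := (derivable_mxP A x v).1 dA i j.
have dBe i j := (derivable_mxP B x v).1 dB i j.
have D i j : is_derive x v (fun y => (A y *m B y) i j)
    (('D_v A x *m B x + A x *m 'D_v B x) i j).
  rewrite (_ : (fun y => _) = \sum_k (fun y => A y i k) * (fun y => B y k j)).
    apply: is_derive_eq.
      apply: is_derive_sum => k; apply: is_deriveM; exact: derivableP.
    rewrite !mxE -big_split /=; apply: eq_bigr => k _.
    rewrite derive_mx // mxE derive_mx // mxE addrC.
    by rewrite /GRing.scale /= (mulrC (B x k j)).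
  by apply/funext => y; rewrite mxE fct_sumE.
have dAB : derivable (fun y => A y *m B y) x v.
  by apply/derivable_mxP => i j; have [] := D i j.
apply: DeriveDef => //; rewrite derive_mx //; apply/matrixP => i j.
by rewrite [LHS]mxE; have [_] := D i j.
Qed.

Lemma is_derive_trmx m n (A : V -> 'M[R]_(m, n)) x v : derivable A x v ->
  is_derive x v (fun y => (A y)^T) ('D_v A x)^T.
Proof.
move=> dA; have dAe i j := (derivable_mxP A x v).1 dA i j.
have dT : derivable (fun y => (A y)^T) x v.
  apply/derivable_mxP => i j; rewrite (_ : (fun _ => _) = fun y => A y j i) //.
  by apply/funext => y; rewrite mxE.
apply: DeriveDef => //; apply/matrixP => i j.
rewrite (derive_mx dT) (derive_mx dA) !mxE.
rewrite (_ : (fun y => _) = fun y => A y j i) //.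
by apply/funext => y; rewrite mxE.
Qed.

(** The difference quotients of both sides are the same function. *)
Lemma is_derive_line (X : normedModType R) (f : V -> X) (p u : V) (s : R) :
  derivable f (p + s *: u) u ->
  is_derive s 1 (fun r => f (p + r *: u)) ('D_u f (p + s *: u)).
Proof.
have E : (fun h : R =>
      h^-1 *: (f (p + (h *: (1 : R) + s) *: u) - f (p + s *: u)))
    = fun h => h^-1 *: (f (h *: u + (p + s *: u)) - f (p + s *: u)).
  apply/funext => h; congr (_ *: (f _ - _)).
  by rewrite /GRing.scale /= mulr1 -/(GRing.scale _ _) scalerDl addrCA.
move=> df; split; first by rewrite /derivable /= E.
by rewrite /derive /= E.
Qed.

End derivatives.

Section Schwarz.
Context (R : realType) (V : normedModType R) (U : set V) (x : V).
Hypotheses (oU : open U) (Ux : U x).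

(** Two applications of the mean value theorem, first in the direction v and
    then in the direction u, write the second difference as h^2 times a value
    of the mixed derivative at a point that tends to x with h. *)
Lemma second_difference (f : V -> R) (u v : V) (e : R) : Ck 2 U f -> 0 < e ->
  exists2 d : R, 0 < d & forall h : R, 0 < h < d ->
    `|f (x + h *: u + h *: v) - f (x + h *: v) - (f (x + h *: u) - f x)
      - h ^+ 2 * 'D_u ('D_v f) x| <= e * h ^+ 2.
Proof.
move=> [df Df] e0; have [dDf cDf] := Df v.
have : \forall y \near x, U y /\ `|'D_u ('D_v f) x - 'D_u ('D_v f) y| < e.
  have /cvgrPdist_lt /(_ _ e0) close := cDf u x Ux.
  near=> y; split; first by near: y; exact: open_nbhs_nbhs.
  by near: y.
move=> /nbhs_ballP [r /= r0 Hr].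
(* The summand 1 keeps c positive when u = v = 0. *)
pose c := `|u| + `|v| + 1.
have c0 : 0 < c by rewrite ltr_wpDl // addr_ge0.
exists (r / c); first exact: divr_gt0.
move=> h /andP[h0 hd].
have near_x s t : 0 <= s <= h -> 0 <= t <= h ->
    ball x r (x + s *: u + t *: v).
  move=> /andP[s0 sh] /andP[t0 th]; rewrite -ball_normE /= -addrA opprD addNKr.
  rewrite normrN; apply: (le_lt_trans (ler_normD _ _)); rewrite !normrZ.
  rewrite !ger0_norm //; apply: (@le_lt_trans _ _ (h * (`|u| + `|v|))).
    by rewrite mulrDr lerD // ler_wpM2r.
  apply: (@lt_trans _ _ (h * c)); first by rewrite ltr_pM2l // ltrDl.
  by rewrite -ltr_pdivlMr.
have h00 : 0 <= h <= h by rewrite lexx ltW.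
have z0h : (0 : R) <= 0 <= h by rewrite lexx ltW.
have sub_itv (s : R) : s \in `]0, h[ -> 0 <= s <= h.
  by rewrite in_itv /= => /andP[s0 sh]; rewrite !ltW.
have der_f s t : 0 <= s <= h -> 0 <= t <= h ->
    is_derive t 1 (fun t => f (x + s *: u + t *: v))
      ('D_v f (x + s *: u + t *: v)).
  move=> sh th; apply: is_derive_line; apply: diff_derivable; apply: df.
  by have [] := Hr _ (near_x _ _ sh th).
have der_Df s t : 0 <= s <= h -> 0 <= t <= h ->
    is_derive s 1 (fun s => 'D_v f (x + s *: u + t *: v))
      ('D_u ('D_v f) (x + s *: u + t *: v)).
  move=> sh th; rewrite (_ : (fun s => _) =
    fun s => 'D_v f (x + t *: v + s *: u)); last first.
    by apply/funext => r'; rewrite addrAC.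
  rewrite addrAC; apply: is_derive_line; rewrite addrAC.
  apply: diff_derivable; apply: dDf.
  by have [] := Hr _ (near_x _ _ sh th).
pose q t := f (x + h *: u + t *: v) - f (x + 0 *: u + t *: v).
pose q' t := 'D_v f (x + h *: u + t *: v) - 'D_v f (x + 0 *: u + t *: v).
have der_q t : 0 <= t <= h -> is_derive t 1 q (q' t).
  by move=> th; apply: is_deriveB; apply: der_f.
have in_cc (s : R) : s \in `[0, h] -> 0 <= s <= h by rewrite in_itv.
have cq : {within `[0, h], continuous q}.
  by apply: derivable_within_continuous => t /in_cc /der_q [].
have [t tI] := MVT h0 (fun t tI => der_q t (sub_itv t tI)) cq.
rewrite /q /q' !scale0r !addr0 subr0 => ->.
have th := sub_itv _ tI.
pose p s := 'D_v f (x + s *: u + t *: v).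
have cp : {within `[0, h], continuous p}.
  apply: derivable_within_continuous => s /in_cc sI.
  by have [] := der_Df s t sI th.
have [s sI] := @MVT _ p _ _ _ h0 (fun s sI => der_Df s t (sub_itv s sI) th) cp.
rewrite /p !scale0r !addr0 subr0 => ->.
have [_ /ltW le_e] := Hr _ (near_x _ _ (sub_itv _ sI) th).
rewrite -mulrA -expr2 mulrC -mulrBr normrM mulrC.
rewrite [X in _ * X]ger0_norm ?sqr_ge0 //.
by rewrite distrC ler_wpM2r // sqr_ge0.
Unshelve. all: by end_near. Qed.

(** The second difference is symmetric in u and v, while after division by h^2
    it tends to the one mixed derivative or to the other. *)
Lemma derive_sym_real (f : V -> R) (u v : V) : Ck 2 U f ->
  'D_u ('D_v f) x = 'D_v ('D_u f) x.
Proof.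
move=> Cf; apply/eqP; rewrite -subr_eq0 -normr_le0.
apply/ler_addgt0Pr => e e0; rewrite add0r.
have e2 : 0 < e / 2 by rewrite divr_gt0.
have [d1 d10 H1] := second_difference u v Cf e2.
have [d2 d20 H2] := second_difference v u Cf e2.
(* A single step that is admissible for both orders of differentiation. *)
pose h := Num.min d1 d2 / 2.
have m0 : 0 < Num.min d1 d2 by rewrite lt_min d10.
have h0 : 0 < h by rewrite divr_gt0.
have hm : h < Num.min d1 d2 by rewrite ltr_pdivrMr // ltr_pMr // ltr1n.
have {H1} := H1 h; rewrite h0 (lt_le_trans hm) ?ge_min ?lexx // => /(_ isT).
have {H2} := H2 h; rewrite h0 (lt_le_trans hm) ?ge_min ?lexx ?orbT //.
move=> /(_ isT).
set a := 'D_v ('D_u f) x; set b := 'D_u ('D_v f) x.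
rewrite (addrAC x (h *: v)).
set A := _ - _ - (_ - _) - h ^+ 2 * a; set B := _ - _ - (_ - _) - h ^+ 2 * b.
move=> HA HB.
have h2 : 0 < h ^+ 2 by rewrite exprn_gt0.
rewrite -(ler_pM2l h2) -[X in X * `|_|](ger0_norm (ltW h2)) -normrM.
have -> : h ^+ 2 * (b - a) = A - B by rewrite /A /B; ring.
apply: (le_trans (ler_normB _ _)); apply: (le_trans (lerD HA HB)).
by rewrite -mulrDl -splitr mulrC.
Qed.

Lemma derive_sym n (f : V -> 'rV[R]_n) (u v : V) : Ck 2 U f ->
  'D_u ('D_v f) x = 'D_v ('D_u f) x.
Proof.
move=> Cf; have [df Df] := Cf.
have nU : nbhs x U by exact: open_nbhs_nbhs.
have E w z i : ('D_w ('D_z f) x) 0 i = 'D_w ('D_z (fun y => f y 0 i)) x.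
  have [dDf _] := Df z.
  rewrite derive_mx ?mxE; last exact/diff_derivable/dDf.
  apply: near_eq_derive; apply: filterS nU => y Uy.
  by rewrite derive_mx ?mxE //; exact/diff_derivable/df.
apply/rowP => i; apply: (etrans (E u v i)); apply: etrans (esym (E v u i)).
exact: derive_sym_real (Ck_coord oU 0 i Cf).
Qed.

End Schwarz.

Lemma Ck_line (R : realType) (V W : normedModType R) k (U : set V)
    (f : V -> W) (x u : V) :
  Ck k U f -> Ck k [set s : R | U (x + s *: u)] (fun s : R => f (x + s *: u)).
Proof.
have cl (s : R) : differentiable (fun s : R => x + s *: u) s.
  apply: differentiableD; first exact: differentiable_cst.
  exact: differentiableZl.
elim: k f => [|k IH] f.
  move=> cf s Us; apply: (@continuous_comp _ _ _ (fun s : R => x + s *: u) f).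
    exact: differentiable_continuous.
  exact: cf.
move=> [df Df]; split=> [s Us|h].
  apply: (@differentiable_comp _ _ _ _ (fun s : R => x + s *: u) f) => //.
  exact: df.
rewrite (_ : 'D_h _ = fun s => 'D_(h *: u) f (x + s *: u)).
  exact: IH (Df (h *: u)).
apply/funext => s; rewrite /derive.
rewrite (_ : (fun k : R => k^-1 *: _) = fun k : R =>
  k^-1 *: ((f \o shift (x + s *: u)) (k *: (h *: u)) - f (x + s *: u))) //.
apply/funext => r /=; congr (_ *: (f _ - _)).
by rewrite scalerDl scalerA addrCA.
Qed.

(** * Functions of one real variable *)

Section one_variable.
Context (R : realType).
Implicit Types (f phi l mu v : R -> R) (I J : set R) (x s t : R).

Lemma derive_realE f x u : differentiable f x -> 'D_u f x = u * 'D_1 f x.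
Proof. by move=> df; rewrite !(deriveE _ df) linear_realE. Qed.

Lemma interval_itv I a b x :
  is_interval I -> I a -> I b -> x \in `[a, b] -> I x.
Proof. by move=> iI Ia Ib; rewrite in_itv /=; exact: iI. Qed.

(** Rolle's theorem: equal values would force a zero of the derivative. *)
Lemma derive_neq0_inj I f : is_interval I ->
  (forall x, I x -> differentiable f x) -> (forall x, I x -> 'D_1 f x != 0) ->
  {in I &, injective f}.
Proof.
move=> iI df f0.
have noRolle a b : I a -> I b -> f a = f b -> ~ a < b.
  move=> Ia Ib fab ab.
  have Iab x : x \in `[a, b] -> I x by exact: interval_itv.
  have der x : x \in `[a, b] -> derivable f x 1.
    by move=> /Iab Ix; exact/diff_derivable/df.
  have [||c cab [_ Dc]] := Rolle ab _ _ fab.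
  - by move=> x xab; apply: der; exact: subset_itv_oo_cc.
  - exact: derivable_within_continuous.
  have := f0 c (Iab _ (subset_itv_oo_cc cab)).
  by rewrite Dc eqxx.
move=> a b; rewrite !inE => Ia Ib fab.
have [ab|ba|//] := ltgtP a b; first by have := noRolle _ _ Ia Ib fab.
by have := noRolle _ _ Ib Ia (esym fab).
Qed.

(** Continuity keeps the derivative away from zero on a ball around s, where
    phi is then injective; [near_can_continuousAcan_sym] and
    [is_derive_inverse] turn this germ of left inverse into a differentiable
    two-sided one. *)
Lemma local_inverse J phi s : open J -> J s -> Ck 1 J phi ->
  'D_1 phi s != 0 ->
  exists psi, {near s, cancel phi psi} /\ {near s, continuous phi}.
Proof.
move=> oJ Js [dphi Dphi] phi0.
have nJ : nbhs s J by exact: open_nbhs_nbhs.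
have : \forall r \near s, J r /\ 'D_1 phi r != 0.
  have := Dphi 1 s Js => /cvgr_neq0 /(_ phi0) n0.
  by near=> r; split; near: r.
move=> /nbhs_ballP[e /= e0 He].
have iB : is_interval (ball s e).
  by rewrite ball_itv; exact: interval_is_interval.
have inj : {in (ball s e : set R) &, injective phi}.
  by apply: derive_neq0_inj => // r /He [Jr]; [move=> _; exact: dphi|].
have nB : nbhs s (ball s e) by exact: nbhsx_ballx.
exists (fun t => get [set r | ball s e r /\ phi r = t]); split.
  near=> r; have Br : ball s e r by near: r.
  have [Bg Eg] := @getPex _ [set r' | ball s e r' /\ phi r' = phi r]
    (ex_intro _ r (conj Br erefl)).
  by apply: inj => //; rewrite inE.
near=> r; apply: differentiable_continuous; apply: dphi; near: r; exact: nJ.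
Unshelve. all: by end_near. Qed.

(** If mu \o phi = l then (mu' \o phi) * phi' = l', so mu' satisfies the same
    hypotheses with l' / phi' in place of l: the induction on k never has to
    differentiate the local inverse of phi more than once. *)
Lemma Ck_descend k J phi l mu : open J -> smooth_on J phi ->
  (forall s, J s -> 'D_1 phi s != 0) -> smooth_on J l ->
  (forall s, J s -> mu (phi s) = l s) -> Ck k (phi @` J) mu.
Proof.
move=> oJ Cphi phi0.
have [dphi _] := Cphi 1%N.
have diff_mu m : smooth_on J m ->
    forall n, (forall s, J s -> n (phi s) = m s) ->
    forall s, J s -> differentiable n (phi s).
  move=> Cm n nm s Js; have [dm _] := Cm 1%N.
  have [psi [K cphi]] := local_inverse oJ Js (Cphi 1%N) (phi0 s Js).
  have psis : psi (phi s) = s by exact: nbhs_singleton K.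
  have [cpsi K'] := near_can_continuousAcan_sym K cphi.
  have dpsi : differentiable psi (phi s).
    apply/derivable1_diffP; have ds : is_derive s 1 phi ('D_1 phi s).
      by apply/derivableP/diff_derivable/dphi.
    by have [] := is_derive_inverse K cphi ds (phi0 s Js).
  have Jpsi : \forall t \near phi s, J (psi t).
    have /= := differentiable_continuous dpsi; apply.
    by rewrite /= psis; exact: open_nbhs_nbhs.
  apply: (@near_eq_differentiable _ _ _ (m \o psi)).
    near=> t; have Jt : J (psi t) by near: t.
    by rewrite /= -(nm _ Jt); congr n; near: t.
  by apply: differentiable_comp => //; rewrite psis; exact: dm.
elim: k l mu => [|k IH] l mu Cl mul.
  move=> _ [s Js <-]; apply: differentiable_continuous.
  exact: diff_mu Cl _ mul _ Js.
split=> [_ [s Js <-]|u]; first exact: diff_mu Cl _ mul _ Js.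
(* l' is the function that 'D_u mu \o phi equals. *)
pose l' := fun s => u * ('D_1 l s * ('D_1 phi s)^-1).
apply: (IH l') => [j|s Js].
  apply: CkM => //; first exact: Ck_cst.
  apply: CkM => //; first by have [_] := Cl j.+1; apply.
  by apply: CkV => //; have [_] := Cphi j.+1; apply.
have dmu : differentiable mu (phi s) by exact: diff_mu Cl _ mul _ Js.
rewrite derive_realE //; congr (_ * _); apply/esym/(canLR (mulfK (phi0 s Js))).
rewrite mulrC -derive_realE // -derive_chain //; last exact: dphi.
apply: near_eq_derive; near=> r => /=; apply/esym/mul.
by near: r; exact: open_nbhs_nbhs.
Unshelve. all: by end_near. Qed.

(** I may be unbounded and rho need not be integrable up to the ends of I, so
    v is an integral from an interior point a, with the sign changed to the left
    of a.  Near a given x it differs by a constant from the integral from some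
    b < x, to which the fundamental theorem of calculus applies. *)
Lemma antiderivative I rho : open_interval I ->
  (forall x, I x -> {for x, continuous rho}) ->
  exists v, forall x, I x -> is_derive x 1 v (rho x).
Proof.
move=> [oI iI [a Ia]] crho.
pose mu := @lebesgue_measure R.
pose v x := if a <= x then \int[mu]_(t in `]a, x]) rho t
            else - \int[mu]_(t in `]x, a]) rho t.
exists v => x Ix.
have below y : I y -> exists2 b, I b & b < y.
  move=> Iy; have /nbhs_ballP[e /= e0 He] : nbhs y I by exact: open_nbhs_nbhs.
  exists (y - e / 2); last by rewrite ltrBlDr ltrDl divr_gt0.
  apply: He; rewrite /ball /= opprB addrCA subrr addr0.
  rewrite ger0_norm ?divr_ge0 ?ltW //.
  by rewrite ltr_pdivrMr // ltr_pMr // ltr1n.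
have above y : I y -> exists2 b, I b & y < b.
  move=> Iy; have /nbhs_ballP[e /= e0 He] : nbhs y I by exact: open_nbhs_nbhs.
  exists (y + e / 2); last by rewrite ltrDl divr_gt0.
  apply: He; rewrite /ball /= opprD addrA subrr sub0r normrN.
  rewrite ger0_norm ?divr_ge0 ?ltW //.
  by rewrite ltr_pdivrMr // ltr_pMr // ltr1n.
have Im : I (Num.min a x) by rewrite minEle; case: ifP.
have IM : I (Num.max a x) by rewrite maxEle; case: ifP.
(* [b, u] is a compact interval of I with a and x in its interior. *)
have [b Ib] := below _ Im; rewrite lt_min => /andP[ba bx].
have [u Iu] := above _ IM; rewrite gt_max => /andP[au xu].
have Ibu y : y \in `[b, u] -> I y by exact: interval_itv.
have irho : mu.-integrable `[b, u] (EFin \o rho).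
  apply: continuous_compact_integrable; first exact: segment_compact.
  apply: continuous_in_subspaceT => y; rewrite inE /= => ybu.
  exact/crho/Ibu.
pose F y := \int[mu]_(t in `[b, y]) rho t.
have [dF DF] := @continuous_FTC1 _ rho (BLeft b) x u xu irho bx (crho x Ix).
have irho' y : y <= u -> mu.-integrable `[b, y] (EFin \o rho).
  move=> yu; apply: integrableS irho => //.
  by apply: subset_itvl; rewrite bnd_simp.
have vF y : b < y < u -> v y = F y - F a.
  move=> /andP[byy yu]; rewrite /v; case: ifPn => [ay|].
    by rewrite /F [RHS]Rintegral_itvB ?bnd_simp ?(ltW ba) //; exact/irho'/ltW.
  rewrite -ltNge => ya; rewrite -[RHS]opprB; congr (- _).
  by rewrite /F [RHS]Rintegral_itvB ?bnd_simp ?ltW //; exact/irho'/ltW.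
have nvF : {near x, F \- cst (F a) =1 v}.
  near=> y; rewrite /= vF //; near: y.
  have : nbhs x [set` `]b, u[] by apply: near_in_itvoo; rewrite in_itv /= bx.
  by apply: filterS => y; rewrite /= in_itv.
apply: near_eq_is_derive nvF _.
rewrite -[rho x]subr0; apply: is_deriveB.
by apply: DeriveDef => //; rewrite -derive1E.
Unshelve. all: by end_near. Qed.

End one_variable.

Section real_sign.
Context (R : realType).

(** Intermediate value theorem. *)
Lemma nonvanishing_sign (I : set R) (f : R -> R) : is_interval I ->
  (forall t, I t -> {for t, continuous f}) -> (forall t, I t -> f t != 0) ->
  exists eps : R, (eps = 1 \/ eps = -1) /\ forall t, I t -> 0 < eps * f t.
Proof.
move=> iI cf f0.
have same s t : I s -> I t -> s <= t -> 0 < f s * f t.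
  move=> Is It st; rewrite lt_neqAle eq_sym mulf_neq0 ?f0 //=.
  rewrite leNgt; apply/negP => neg.
  have Ist r : r \in `[s, t] -> I r by exact: interval_itv.
  have cst : {within `[s, t], continuous f}.
    apply: continuous_in_subspaceT => r; rewrite inE /= => rst.
    exact/cf/Ist.
  have [|r rst fr] := @IVT _ f s t 0 st cst.
    have [fs|fs] := leP (f s) (f t); rewrite ?ge_min ?le_max; nra.
  by have := f0 r (Ist r rst); rewrite fr eqxx.
have [[t It]|noI] := pselect (exists t, I t); last first.
  by exists 1; split; [left|move=> t It; case: noI; exists t].
have same' s : I s -> 0 < f t * f s.
  move=> Is; have [st|ts] := leP s t; last by apply: same => //; exact: ltW.
  by rewrite mulrC same.
have := f0 t It; rewrite neq_lt => /orP[ft|ft].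
  exists (-1); split; [by right|move=> s /same'; nra].
exists 1; split; [by left|move=> s /same'; nra].
Qed.

Lemma antiderivative_smooth (I : set R) (rho v : R -> R) : open I ->
  (forall t, I t -> is_derive t 1 v (rho t)) -> smooth_on I rho -> smooth_on I v.
Proof.
move=> oI vd Crho.
have dv t : I t -> differentiable v t.
  by move=> It; apply/derivable1_diffP; have [] := vd t It.
case=> [|k]; first by move=> t /dv; exact: differentiable_continuous.
split=> // u; have : Ck k I (fun t => u * rho t).
  by apply: CkM => //; exact: Ck_cst.
apply: Ck_ext => // t /set_mem It; rewrite derive_realE; last exact: dv.
by have [_ ->] := vd t It.
Qed.

(** A continuous image of an interval is an interval; it is open because v is
    locally invertible. *)
Lemma open_interval_image (I : set R) (v : R -> R) : open_interval I ->
  Ck 1 I v -> (forall t, I t -> 'D_1 v t != 0) -> open_interval (v @` I).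
Proof.
move=> [oI iI [a Ia]] Cv v0; have [dv _] := Cv.
have cv t : I t -> {for t, continuous v}.
  by move=> /dv; exact: differentiable_continuous.
split; last by exists (v a), a.
  rewrite openE => _ [t It <-]; rewrite /interior.
  have [psi [K cvt]] := local_inverse oI It Cv (v0 t It).
  have [cpsi K'] := near_can_continuousAcan_sym K cvt.
  have psit : psi (v t) = t by exact: nbhs_singleton K.
  have nI : nbhs (v t) (psi @^-1` I).
    have := nbhs_singleton cpsi; apply; rewrite psit.
    exact: open_nbhs_nbhs.
  by apply: filterS2 nI K' => y Iy <-; exists (psi y).
apply/connected_intervalP; apply: connected_continuous_connected.
  exact/connected_intervalP.
by apply: continuous_in_subspaceT => t /set_mem; exact: cv.
Qed.

End real_sign.

(** * Bilinear forms and orthonormal frames *)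

Section bilinear_forms.
Context (R : realFieldType).

(** [gdot g c p] unfolds to [bform (g c p)]; the algebra below does not
    depend on a manifold. *)
Definition bform m (G : 'M[R]_m) (u w : 'rV[R]_m) : R := (u *m G *m w^T) 0 0.

Section dimension.
Context (m : nat).
Implicit Types (G B : 'M[R]_m) (u w n : 'rV[R]_m).

Lemma bformDl G u u' w : bform G (u + u') w = bform G u w + bform G u' w.
Proof. by rewrite /bform !mulmxDl mxE. Qed.

Lemma bformDr G u w w' : bform G u (w + w') = bform G u w + bform G u w'.
Proof. by rewrite /bform linearD mulmxDr mxE. Qed.

Lemma bformZl G a u w : bform G (a *: u) w = a * bform G u w.
Proof. by rewrite /bform -!scalemxAl mxE. Qed.

Lemma bformZr G a u w : bform G u (a *: w) = a * bform G u w.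
Proof. by rewrite /bform linearZ -scalemxAr mxE. Qed.

Lemma bformC G u w : G^T = G -> bform G u w = bform G w u.
Proof.
move=> symG; rewrite /bform; have <- : (u *m G *m w^T)^T = w *m G *m u^T.
  by rewrite !trmx_mul trmxK symG mulmxA.
by rewrite [RHS]mxE.
Qed.

Lemma bform_congr G (J : 'M[R]_m) u w :
  bform (J *m G *m J^T) u w = bform G (u *m J) (w *m J).
Proof. by rewrite /bform trmx_mul !mulmxA. Qed.

Lemma row_dot_inj u u' : (forall w, (u *m w^T) 0 0 = (u' *m w^T) 0 0) -> u = u'.
Proof.
move=> uu'; apply/rowP => i; have := uu' (delta_mx 0 i).
by rewrite trmx_delta -!colE !mxE.
Qed.

Lemma bform_ext G B :
  (forall u w, bform G u w = bform B u w) -> G = B.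
Proof.
move=> GB; apply/row_matrixP => i; apply: row_dot_inj => w.
by have := GB (delta_mx 0 i) w; rewrite /bform -!rowE.
Qed.

Lemma bform_nondegenerate G u u' : G \in unitmx ->
  (forall w, bform G u w = bform G u' w) -> u = u'.
Proof.
move=> unitG H; have /row_dot_inj : forall w,
    ((u *m G) *m w^T) 0 0 = (u' *m G *m w^T) 0 0.
  exact: H.
by move=> /(congr1 (mulmx^~ (invmx G))); rewrite !mulmxK.
Qed.

(** If F is the matrix with the rows f i, then F G F^T = D is diagonal with
    entries 1 and -1, so D is its own inverse and F^T D F is the inverse of G;
    the sum is the trace of D F B F^T. *)
Lemma orthonormal_sum_trace G B (f : 'I_m -> 'rV[R]_m) : G \in unitmx ->
  (forall i, bform G (f i) (f i) = 1 \/ bform G (f i) (f i) = -1) ->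
  (forall i j, i != j -> bform G (f i) (f j) = 0) ->
  \sum_i bform G (f i) (f i) * bform B (f i) (f i) = \tr (invmx G *m B).
Proof.
move=> unitG f1 f0; pose F : 'M[R]_m := \matrix_i f i.
have entry (H : 'M[R]_m) i j : (F *m H *m F^T) i j = bform H (f i) (f j).
  rewrite /bform !mxE; apply: eq_bigr => k _; rewrite !mxE; congr (_ * _).
  by apply: eq_bigr => l _; rewrite mxE.
pose d := \row_i bform G (f i) (f i).
have GramD : F *m G *m F^T = diag_mx d.
  apply/matrixP => i j; rewrite entry !mxE; have [->|ij] := eqVneq i j.
    by rewrite mulr1n.
  by rewrite f0 // mulr0n.
have dd1 : diag_mx d *m diag_mx d = 1%:M.
  rewrite mulmx_diag; apply/matrixP => i j; rewrite !mxE.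
  by case: (f1 i) => ->; rewrite ?mulrNN mulr1.
have inv : F^T *m diag_mx d *m F = invmx G.
  have : F *m (G *m F^T *m diag_mx d) = 1%:M by rewrite !mulmxA GramD.
  move=> /mulmx1C; rewrite -!mulmxA => /(congr1 (mulmx (invmx G))).
  by rewrite mulmx1 mulKmx.
rewrite -inv -!mulmxA mxtrace_mulC -!mulmxA /mxtrace.
apply: eq_bigr => i _; rewrite mul_diag_mx mxE; congr (_ * _).
  by rewrite mxE.
by rewrite !mulmxA entry.
Qed.

End dimension.

(** Completing the frame e of the hyperplane orthogonal to n by n itself gives
    an orthonormal frame of the whole space. *)
Lemma hyperplane_frame_sum m (G B : 'M[R]_m.+1) (n : 'rV[R]_m.+1)
    (e : 'I_m -> 'rV[R]_m.+1) : G \in unitmx -> G^T = G ->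
  (bform G n n = 1 \/ bform G n n = -1) ->
  (forall i, bform G n (e i) = 0) ->
  (forall i, bform G (e i) (e i) = 1 \/ bform G (e i) (e i) = -1) ->
  (forall i j, i != j -> bform G (e i) (e j) = 0) ->
  \sum_i bform G (e i) (e i) * bform B (e i) (e i) =
    \tr (invmx G *m B) - bform G n n * bform B n n.
Proof.
move=> unitG symG n1 ne e1 e0.
(* The normal n gets index 0, and the frame the indices above it. *)
pose f i := if unlift ord0 i is Some j then e j else n.
rewrite -(@orthonormal_sum_trace _ G B f) //.
- rewrite big_ord_recl {1 2 3 4}/f unlift_none addrAC subrr add0r.
  by apply: eq_bigr => i _; rewrite /f liftK.
- by move=> i; rewrite /f; case: unliftP => [j|] _.
move=> i j; rewrite /f; case: unliftP => [i'|] ->; case: unliftP => [j'|] ->.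
- by move=> ij; apply: e0; apply: contraNneq ij => ->.
- by rewrite bformC.
- by [].
- by rewrite eqxx.
Qed.

(** The right hand side of [hyperplane_frame_sum] does not mention the frame. *)
Lemma hyperplane_frame_sum_eq m (G B : 'M[R]_m) (n : 'rV[R]_m)
    (e e' : 'I_m.-1 -> 'rV[R]_m) : G \in unitmx -> G^T = G ->
  (bform G n n = 1 \/ bform G n n = -1) ->
  (forall i, bform G n (e i) = 0) ->
  (forall i, bform G (e i) (e i) = 1 \/ bform G (e i) (e i) = -1) ->
  (forall i j, i != j -> bform G (e i) (e j) = 0) ->
  (forall i, bform G n (e' i) = 0) ->
  (forall i, bform G (e' i) (e' i) = 1 \/ bform G (e' i) (e' i) = -1) ->
  (forall i j, i != j -> bform G (e' i) (e' j) = 0) ->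
  \sum_i bform G (e i) (e i) * bform B (e i) (e i) =
  \sum_i bform G (e' i) (e' i) * bform B (e' i) (e' i).
Proof.
case: m G B n e e' => [|m] G B n e e'; first by rewrite !big_ord0.
move=> uG sG n1 ne e1 e0 ne' e1' e0'.
rewrite (hyperplane_frame_sum _ uG sG n1 ne) //.
by rewrite (hyperplane_frame_sum _ uG sG n1 ne').
Qed.

(** The index k of the Christoffel symbol is contracted with G, which cancels
    the inverse of G.  In the remaining sum over i, j, l with the weights
    u_i y_j u_l, the first and the third term cancel on exchanging i and l. *)
Lemma christoffel_contraction m (G : 'M[R]_m) (dG : 'I_m -> 'M[R]_m)
    (u y : 'rV[R]_m) : G \in unitmx -> G^T = G -> (forall k, (dG k)^T = dG k) ->
  bform G (\row_k \sum_i \sum_j (2^-1 * \sum_l invmx G k l *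
      (dG i j l + dG j i l - dG l i j)) * u 0 i * y 0 j) u =
    2^-1 * bform (\sum_k y 0 k *: dG k) u u.
Proof.
move=> unitG symG symdG.
pose T := \row_l \sum_i \sum_j (dG i j l + dG j i l - dG l i j) * u 0 i * y 0 j.
have -> : \row_k \sum_i \sum_j (2^-1 * \sum_l invmx G k l *
      (dG i j l + dG j i l - dG l i j)) * u 0 i * y 0 j = 2^-1 *: (T *m invmx G).
  apply/rowP => k; rewrite !mxE.
  under [in RHS]eq_bigr => l _.
    rewrite mxE mulr_suml; under eq_bigr do rewrite mulr_suml.
    over.
  rewrite [in RHS]exchange_big mulr_sumr; apply: eq_bigr => i _ /=.
  rewrite [in RHS]exchange_big mulr_sumr; apply: eq_bigr => j _ /=.
  rewrite -!mulrA; congr (_ * _); rewrite mulr_suml; apply: eq_bigr => l _.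
  have -> : invmx G l k = invmx G k l.
    by rewrite -[in LHS]symG -trmx_inv mxE.
  by ring.
rewrite bformZl; congr (_ * _); rewrite /bform mulmxKV // !mxE.
have -> : \sum_j T 0 j * u^T j 0 =
  \sum_i \sum_j \sum_l (dG i j l + dG j i l - dG l i j) * u 0 i * y 0 j * u 0 l.
  under eq_bigr => l _.
    rewrite !mxE mulr_suml; under eq_bigr do rewrite mulr_suml.
    over.
  by rewrite exchange_big; apply: eq_bigr => i _ /=; rewrite exchange_big.
have -> : \sum_j (u *m (\sum_k y 0 k *: dG k)) 0 j * u^T j 0 =
    \sum_i \sum_j \sum_l dG j i l * u 0 i * y 0 j * u 0 l.
  under eq_bigr => l _.
    rewrite !mxE mulr_suml; under eq_bigr => i _.
      rewrite summxE mulr_sumr mulr_suml; under eq_bigr do rewrite !mxE.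
      over.
    over.
  rewrite exchange_big; apply: eq_bigr => i _; rewrite exchange_big.
  by apply: eq_bigr => j _; apply: eq_bigr => l _; ring.
apply/eqP; rewrite -subr_eq0; apply/eqP.
have -> : \sum_i \sum_j \sum_l (dG i j l + dG j i l - dG l i j) * u 0 i * y 0 j
      * u 0 l - \sum_i \sum_j \sum_l dG j i l * u 0 i * y 0 j * u 0 l =
    \sum_i \sum_j \sum_l dG i j l * u 0 i * y 0 j * u 0 l
    - \sum_i \sum_j \sum_l dG l i j * u 0 i * y 0 j * u 0 l.
  rewrite -!sumrB; apply: eq_bigr => i _; rewrite -!sumrB; apply: eq_bigr => j _.
  by rewrite -!sumrB; apply: eq_bigr => l _; ring.
apply/eqP; rewrite subr_eq0; apply/eqP.
rewrite exchange_big [RHS]exchange_big; apply: eq_bigr => j _ /=.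
rewrite exchange_big; apply: eq_bigr => i _; apply: eq_bigr => l _.
by rewrite -[in LHS](symdG l) mxE; ring.
Qed.

End bilinear_forms.

(** * Invariance of the Lie derivative of a metric *)

Section half_lie_derivative.
Context (R : realType) (m : nat).
Local Notation V := 'rV[R]_m.
Implicit Types (G : V -> 'M[R]_m) (N : V -> V) (x X : V).

(** Half the Lie derivative of the metric G along N, evaluated on (X, X): the
    value of g(nabla_X N, X) without Christoffel symbols. *)
Definition half_lie G N x X : R :=
  bform (G x) ('D_X N x) X + 2^-1 * bform ('D_(N x) G x) X X.

Lemma row_jacobian (phi : V -> V) x X : differentiable phi x ->
  X *m jacobian phi x = 'D_X phi x.
Proof. by move=> dphi; rewrite deriveE // mul_rV_lin1. Qed.

Lemma derivable_jacobian (U : set V) (phi : V -> V) x v : open U -> U x ->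
  Ck 2 U phi -> derivable (jacobian phi) x v.
Proof.
move=> oU Ux [dphi Dphi]; apply/derivable_mxP => i j.
apply: (@near_eq_derivable _ _ _ (fun y => 'D_(delta_mx 0 i) phi y 0 j)).
  apply: filterS (open_nbhs_nbhs (conj oU Ux)) => y Uy.
  by rewrite -row_jacobian -?rowE ?mxE //; exact: dphi.
apply: ((derivable_mxP _ _ _).1 _ 0 j); apply: diff_derivable.
by have [dD _] := Dphi (delta_mx 0 i); exact: dD.
Qed.

(** The directional derivatives of the Jacobian matrix are second derivatives
    of phi, which makes their symmetry available to matrix computations. *)
Lemma derive_jacobian (U : set V) (phi : V -> V) x v X : open U -> U x ->
  Ck 2 U phi -> X *m 'D_v (jacobian phi) x = 'D_v ('D_X phi) x.
Proof.
move=> oU Ux C2; have [dphi _] := C2.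
have dJ := @derivable_jacobian U phi x v oU Ux C2.
have dX : derivable (fun _ : V => X) x v by exact: derivable_cst.
have [_ E] := is_derive_mulmx dX dJ.
rewrite derive_cst mul0mx add0r in E; rewrite -E; apply: near_eq_derive.
apply: filterS (open_nbhs_nbhs (conj oU Ux)) => y Uy.
by rewrite row_jacobian //; exact: dphi.
Qed.

(** The identities Gc = J (Gd \o phi) J^T and Nd \o phi = Nc J hold on an open
    set, so they can be differentiated, the first in the direction n of the
    normal and the second in the direction X.  Both derivatives contain a
    second derivative of phi in the directions X and n; by symmetry the two
    contributions to the half Lie derivative are equal, and they cancel. *)
Lemma half_lie_isometry (U : set V) (phi : V -> V) (Gc Gd : V -> 'M[R]_m)
    (Nc Nd : V -> V) x X : open U -> U x -> Ck 2 U phi ->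
  differentiable Gd (phi x) -> differentiable Nd (phi x) ->
  derivable Nc x X -> (Gd (phi x))^T = Gd (phi x) ->
  (forall y, U y -> Gc y = jacobian phi y *m Gd (phi y) *m (jacobian phi y)^T) ->
  (forall y, U y -> Nd (phi y) = Nc y *m jacobian phi y) ->
  half_lie Gd Nd (phi x) (X *m jacobian phi x) = half_lie Gc Nc x X.
Proof.
move=> oU Ux C2 dGd dNd dNc symG isoG isoN.
have dphi : differentiable phi x by have [+ _] := C2; apply.
have nU : nbhs x U by exact: open_nbhs_nbhs.
have dJ v := @derivable_jacobian U phi x v oU Ux C2.
set J := jacobian phi x; set n := Nc x; set y := phi x in symG dGd dNd *.
have Ndy : Nd y = n *m J by exact: isoN.
have DN : 'D_(X *m J) Nd y = 'D_X Nc x *m J + n *m 'D_X (jacobian phi) x.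
  rewrite row_jacobian // -derive_chain //.
  have [_ <-] := is_derive_mulmx dNc (dJ X).
  by apply: near_eq_derive; apply: filterS nU => z Uz; exact: isoN.
have dGphi : derivable (Gd \o phi) x n.
  by apply: diff_derivable; exact: differentiable_comp.
have DG : 'D_n Gc x = ('D_n (jacobian phi) x *m Gd y + J *m 'D_(Nd y) Gd y) *m J^T
    + (J *m Gd y) *m ('D_n (jacobian phi) x)^T.
  have [d1 e1] := is_derive_mulmx (dJ n) dGphi.
  have [d2 e2] := is_derive_trmx (dJ n).
  have [_ e3] := is_derive_mulmx d1 d2.
  rewrite Ndy row_jacobian // -derive_chain // -/J.
  rewrite e1 e2 in e3; rewrite -e3; apply: near_eq_derive.
  by apply: filterS nU => z Uz; exact: isoG.
have sym : X *m 'D_n (jacobian phi) x = n *m 'D_X (jacobian phi) x.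
  rewrite (@derive_jacobian U phi x n X oU Ux C2).
  rewrite (@derive_jacobian U phi x X n oU Ux C2).
  exact: (derive_sym oU Ux _ _ C2).
set K := 'D_n (jacobian phi) x in sym DG; set H := 'D_(Nd y) Gd y in DG.
set D := 'D_X Nc x in DN.
have -> : half_lie Gd Nd y (X *m J) =
    bform (Gd y) (D *m J + X *m K) (X *m J) + 2^-1 * bform H (X *m J) (X *m J).
  by rewrite sym; congr (bform _ _ _ + _); exact: DN.
have -> : half_lie Gc Nc x X = bform (J *m Gd y *m J^T) D X + 2^-1 *
    bform ((K *m Gd y + J *m H) *m J^T + J *m Gd y *m K^T) X X.
  rewrite /half_lie; congr (_ + _ * _).
    by congr (bform _ _ _); exact: isoG.
  by congr (bform _ _ _); exact: DG.
rewrite bform_congr bformDl.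
have -> : bform ((K *m Gd y + J *m H) *m J^T + J *m Gd y *m K^T) X X =
   bform H (X *m J) (X *m J) + 2 * bform (Gd y) (X *m K) (X *m J).
  have -> : (K *m Gd y + J *m H) *m J^T + J *m Gd y *m K^T =
      K *m Gd y *m J^T + J *m H *m J^T + J *m Gd y *m K^T by rewrite mulmxDl.
  rewrite {1}/bform !mulmxDr !mulmxDl [LHS]mxE [X in X + _]mxE.
  have -> : (X *m (K *m Gd y *m J^T) *m X^T) 0 0 =
      bform (Gd y) (X *m K) (X *m J).
    by rewrite /bform trmx_mul !mulmxA.
  have -> : (X *m (J *m Gd y *m K^T) *m X^T) 0 0 =
      bform (Gd y) (X *m J) (X *m K).
    by rewrite /bform trmx_mul !mulmxA.
  rewrite -[X in _ + X + _]/(bform _ X X) bform_congr (bformC (X *m J) _ symG).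
  by ring.
by field.
Qed.

End half_lie_derivative.

(** * Gradients, isometries and mean curvature in charts *)

Lemma open_chart_image (R : realType) (V : normedModType R)
    (M : topologicalType) (c : chart V M) (W : set M) :
  is_chart c -> open W -> open (cmap c @` (cdom c `&` W)).
Proof.
move=> [oc oimg K _ cK] oW; rewrite openE => _ [p [cp Wp] <-].
have nimg : nbhs (cmap c p) (cmap c @` cdom c).
  by apply: open_nbhs_nbhs; split => //; exists p.
have nW : nbhs (cmap c p) (cinv c @^-1` W).
  by apply: (cK p cp); apply: open_nbhs_nbhs; split => //; rewrite /= K.
rewrite /interior; apply: filterS2 nimg nW => _ [q cq <-] /=.
by rewrite K // => Wq; exists q.
Qed.

Section manifold.
Context (R : realType) (m : nat) (M : topologicalType).
Context (A : set (chart 'rV[R]_m M)) (g : chart 'rV[R]_m M -> M -> 'M[R]_m).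
Hypotheses (Mman : smooth_manifold A) (gmet : semi_riemannian A g).
Implicit Types (c d : chart 'rV[R]_m M) (p q : M) (f : M -> R)
  (u w : 'rV[R]_m).

Lemma atlas_chart c : A c -> is_chart c.
Proof. by move=> Ac; have [_ _ + _ _] := Mman; apply. Qed.

Lemma cmapK c p : A c -> cdom c p -> cinv c (cmap c p) = p.
Proof. by move=> /atlas_chart[_ _ + _ _]; apply. Qed.

Lemma open_image c : A c -> open (cmap c @` cdom c).
Proof. by move=> /atlas_chart[]. Qed.

Lemma chart_at p : exists2 c, A c & cdom c p.
Proof. by have [_ _ _ + _] := Mman; apply. Qed.

Lemma gram_sym c p : A c -> cdom c p -> (g c p)^T = g c p.
Proof. by move=> Ac cp; have [_ + _ _] := gmet; apply. Qed.

Lemma gram_unit c p : A c -> cdom c p -> g c p \in unitmx.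
Proof. by move=> Ac cp; have [_ _ + _] := gmet; apply. Qed.

Lemma gram_smooth c : A c -> smooth_on (cmap c @` cdom c) (g c \o cinv c).
Proof. by move=> Ac; have [+ _ _ _] := gmet; apply. Qed.

Definition smooth_function f := smooth_map A (@model_atlas R R) f.

Lemma smooth_function_chart f c : smooth_function f -> A c ->
  smooth_on (cmap c @` cdom c) (f \o cinv c).
Proof.
move=> [_ sf] Ac k; have := sf c (Chart setT id id) Ac erefl k.
by rewrite /= preimage_setT setIT.
Qed.

Lemma smooth_function_continuous f : smooth_function f -> continuous f.
Proof. by case. Qed.

Lemma difE f c p u : smooth_function f -> A c -> cdom c p ->
  dif c f p u = 'D_u (f \o cinv c) (cmap c p).
Proof.
move=> sf Ac cp; rewrite /dif deriveE //.
by have [+ _] := smooth_function_chart sf Ac 1%N; apply; exists p.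
Qed.

Lemma gdot_grad f c p u : A c -> cdom c p ->
  gdot g c p (grad g c f p) u = dif c f p u.
Proof.
move=> Ac cp; rewrite /gdot /grad mulmxKV ?gram_unit // mxE.
rewrite {2}[u]row_sum_delta /dif linear_sum; apply: eq_bigr => i _.
by rewrite linearZ !mxE mulrC.
Qed.

Lemma grad_smooth f c i k : smooth_function f -> A c ->
  Ck k (cmap c @` cdom c) (fun y => grad g c f (cinv c y) 0 i).
Proof.
move=> sf Ac; have oU := open_image Ac.
rewrite (_ : (fun y => _) = fun y => \sum_j pderiv c j f (cinv c y) *
    invmx (g c (cinv c y)) j i); last first.
  by apply/funext => y; rewrite mxE; apply: eq_bigr => j _; rewrite mxE.
apply: Ck_sum => // j _; apply: CkM => //.
  have [_ D] := smooth_function_chart sf Ac k.+1.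
  apply: Ck_ext (D (delta_mx 0 j)) => // _ /set_mem[q cq <-].
  by rewrite cmapK // /pderiv difE.
apply: (Ck_invmx oU (F := g c \o cinv c)) => [_ [q cq <-]|a b] /=.
  by rewrite cmapK // gram_unit.
by apply: (Ck_coord oU (F := g c \o cinv c)); exact: gram_smooth.
Qed.

Lemma grad_differentiable f c p : smooth_function f -> A c -> cdom c p ->
  differentiable (grad g c f \o cinv c) (cmap c p).
Proof.
move=> sf Ac cp; apply: differentiable_mx => i j; rewrite ord1.
by have [+ _] := @grad_smooth f c j 1 sf Ac; apply; exists p.
Qed.

Lemma gram_differentiable c p : A c -> cdom c p ->
  differentiable (g c \o cinv c) (cmap c p).
Proof. by move=> Ac cp; have [+ _] := gram_smooth Ac 1%N; apply; exists p. Qed.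

(** [christoffel_contraction], with the matrices of partial derivatives of the
    metric, whose combination with the components of N is the derivative in the
    direction N. *)
Lemma gdot_covariant_derivative f c p u : smooth_function f -> A c ->
  cdom c p ->
  gdot g c p (covariant_derivative g c (grad g c f) p u) u =
  half_lie (g c \o cinv c) (grad g c f \o cinv c) (cmap c p) u.
Proof.
move=> sf Ac cp; rewrite /half_lie /= cmapK // -/(bform _ _ _).
rewrite /gdot -/(bform _ _ _) /covariant_derivative bformDl.
rewrite -deriveE; last exact: grad_differentiable.
congr (_ + _).
have dG := gram_differentiable Ac cp.
pose D k : 'M[R]_m := 'D_(delta_mx 0 k) (g c \o cinv c) (cmap c p).
have DE k i j : pderiv c k (fun q => g c q i j) p = D k i j.
  rewrite /D derive_mx; last exact: diff_derivable.
  rewrite mxE deriveE //.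
  exact: (differentiable_comp dG (differentiable_coord _ i j)).
have symD k : (D k)^T = D k.
  have dGk : derivable (g c \o cinv c) (cmap c p) (delta_mx 0 k).
    exact: diff_derivable.
  have [_ <-] := is_derive_trmx dGk.
  apply: near_eq_derive.
  apply: filterS (open_nbhs_nbhs (conj (open_image Ac) _)); last by exists p.
  by move=> _ [q cq <-] /=; rewrite cmapK // gram_sym.
rewrite (deriveE _ dG) {2}[grad g c f p]row_sum_delta linear_sum.
have -> : \sum_i 'd (g c \o cinv c) (cmap c p) (grad g c f p 0 i *: delta_mx 0 i)
    = \sum_k grad g c f p 0 k *: D k.
  by apply: eq_bigr => k _; rewrite linearZ /D deriveE.
rewrite -(christoffel_contraction _ _ (gram_unit Ac cp) (gram_sym Ac cp)) //.
congr (bform _ _ _); apply/rowP => k; rewrite !mxE.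
apply: eq_bigr => i _; apply: eq_bigr => j _; congr (_ * _ * _ * _).
by apply: eq_bigr => l _; rewrite !DE.
Qed.

Section isometry.
Context (phi : M -> M) (f : M -> R).
Hypotheses (phi_smooth : smooth_map A A phi).
Hypotheses (phi_iso : preserves_metric A g phi).
Hypotheses (f_smooth : smooth_function f) (f_inv : forall p, f (phi p) = f p).
Context (c d : chart 'rV[R]_m M).
Hypotheses (Ac : A c) (Ad : A d).

Let T : 'rV[R]_m -> 'rV[R]_m := cmap d \o phi \o cinv c.
Let W := cmap c @` (cdom c `&` phi @^-1` cdom d).

Lemma isometry_open : open W.
Proof.
have [cphi _] := phi_smooth.
apply: open_chart_image; first exact: atlas_chart.
apply: open_comp => [p _|]; first exact: cphi.
by have [] := atlas_chart Ad.
Qed.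

Lemma isometry_Ck k : Ck k W T.
Proof. by have [_] := phi_smooth; apply. Qed.

Lemma isometry_differentiable p : cdom c p -> cdom d (phi p) ->
  differentiable T (cmap c p).
Proof. by move=> cp dp; have [+ _] := isometry_Ck 1; apply; exists p. Qed.

Lemma isometry_chart p : cdom c p -> T (cmap c p) = cmap d (phi p).
Proof. by move=> cp; rewrite /T /= cmapK. Qed.

Lemma tangent_mapE p u : tangent_map c d phi p u = u *m jacobian T (cmap c p).
Proof. by rewrite mul_rV_lin1. Qed.

Lemma isometry_metric p : cdom c p -> cdom d (phi p) ->
  g c p = jacobian T (cmap c p) *m g d (phi p) *m (jacobian T (cmap c p))^T.
Proof.
move=> cp dp; apply: bform_ext => u w; rewrite bform_congr -!tangent_mapE.
by rewrite -[LHS](phi_iso Ac Ad cp dp).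
Qed.

(** The Gram matrix at p is invertible and factors through the Jacobian. *)
Lemma isometry_unit p : cdom c p -> cdom d (phi p) ->
  jacobian T (cmap c p) \in unitmx.
Proof.
move=> cp dp; have := gram_unit Ac cp; rewrite isometry_metric //.
by rewrite !unitmx_mul => /andP[/andP[]].
Qed.

Lemma isometry_dif p u : cdom c p -> cdom d (phi p) ->
  dif d f (phi p) (u *m jacobian T (cmap c p)) = dif c f p u.
Proof.
move=> cp dp; rewrite !difE // row_jacobian; last exact: isometry_differentiable.
rewrite -isometry_chart // -derive_chain; first last.
- rewrite isometry_chart //.
  by have [+ _] := smooth_function_chart f_smooth Ad 1%N; apply; exists (phi p).
- exact: isometry_differentiable.
apply: near_eq_derive.
apply: filterS (open_nbhs_nbhs (conj isometry_open _)); last by exists p.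
by move=> _ [q [cq dq] <-]; rewrite /= /T /= !cmapK.
Qed.

(** The gradient is determined by its products with all vectors, which are
    values of the differential, and each vector is in the image of the
    invertible Jacobian. *)
Lemma isometry_grad p : cdom c p -> cdom d (phi p) ->
  grad g d f (phi p) = grad g c f p *m jacobian T (cmap c p).
Proof.
move=> cp dp; apply: (bform_nondegenerate (gram_unit Ad dp)) => w.
have uJ := isometry_unit cp dp.
rewrite -[w](mulmxKV uJ); set w' := w *m _.
rewrite -[RHS]bform_congr -isometry_metric // [RHS]gdot_grad //.
by rewrite [LHS]gdot_grad // isometry_dif.
Qed.

Lemma isometry_half_lie p u : cdom c p -> cdom d (phi p) ->
  half_lie (g d \o cinv d) (grad g d f \o cinv d) (cmap d (phi p))
    (u *m jacobian T (cmap c p)) =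
  half_lie (g c \o cinv c) (grad g c f \o cinv c) (cmap c p) u.
Proof.
move=> cp dp; rewrite -isometry_chart //.
have Wp : W (cmap c p) by exists p.
apply: (half_lie_isometry isometry_open Wp (isometry_Ck 2)).
- by rewrite isometry_chart //; exact: gram_differentiable.
- by rewrite isometry_chart //; exact: grad_differentiable.
- exact/diff_derivable/grad_differentiable.
- by rewrite isometry_chart //= cmapK // gram_sym.
- by move=> _ [q [cq dq] <-]; rewrite isometry_chart //= !cmapK // isometry_metric.
- by move=> _ [q [cq dq] <-]; rewrite isometry_chart //= !cmapK // isometry_grad.
Qed.

Lemma isometry_gdot p u w : cdom c p -> cdom d (phi p) ->
  gdot g d (phi p) (u *m jacobian T (cmap c p)) (w *m jacobian T (cmap c p)) =
  gdot g c p u w.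
Proof. by move=> cp dp; rewrite -!tangent_mapE phi_iso. Qed.

Lemma isometry_frame p e : cdom c p -> cdom d (phi p) ->
  orthonormal_frame g c p (ker_dif c f p) e ->
  orthonormal_frame g d (phi p) (ker_dif d f (phi p))
    (fun i => e i *m jacobian T (cmap c p)).
Proof.
move=> cp dp [Ke e1 e0]; split=> [i|i|i j ij]; rewrite ?isometry_gdot //.
- by rewrite /ker_dif /= isometry_dif //; exact: Ke.
- exact: e0.
Qed.

Lemma isometry_mean_curvature p e : cdom c p -> cdom d (phi p) ->
  mean_curvature g d f (phi p) (fun i => e i *m jacobian T (cmap c p)) =
  mean_curvature g c f p e.
Proof.
move=> cp dp; apply: eq_bigr => i _.
by rewrite isometry_gdot // !gdot_covariant_derivative // isometry_half_lie.
Qed.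

End isometry.

(** The terms of the sum are values of one quadratic form B on the frame, and
    the frame spans the hyperplane orthogonal to the unit vector grad f. *)
Lemma mean_curvature_frame f c p e e' : smooth_function f -> A c -> cdom c p ->
  (gdot g c p (grad g c f p) (grad g c f p) = 1 \/
   gdot g c p (grad g c f p) (grad g c f p) = -1) ->
  orthonormal_frame g c p (ker_dif c f p) e ->
  orthonormal_frame g c p (ker_dif c f p) e' ->
  mean_curvature g c f p e = mean_curvature g c f p e'.
Proof.
move=> sf Ac cp.
pose G := g c \o cinv c; pose N := grad g c f \o cinv c.
pose B : 'M[R]_m := lin1_mx ('d N (cmap c p)) *m g c p
  + 2^-1 *: 'D_(N (cmap c p)) G (cmap c p).
have BE u : half_lie G N (cmap c p) u = bform B u u.
  rewrite /half_lie deriveE; last exact: grad_differentiable.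
  rewrite /bform mulmxDr mulmxDl [RHS]mxE; congr (_ + _).
    by rewrite mulmxA mul_rV_lin1 /G /= cmapK.
  by rewrite -scalemxAr -scalemxAl [RHS]mxE.
have mcE e0 : mean_curvature g c f p e0 =
    \sum_i bform (g c p) (e0 i) (e0 i) * bform B (e0 i) (e0 i).
  by apply: eq_bigr => i _; rewrite gdot_covariant_derivative // BE.
move=> n1 [Ke e1 e0] [Ke' e1' e0']; rewrite !mcE.
have perp u : ker_dif c f p u -> bform (g c p) (grad g c f p) u = 0.
  by move=> Ku; rewrite -[LHS]/(gdot _ _ _ _ _) gdot_grad.
apply: (@hyperplane_frame_sum_eq _ _ (g c p) B (grad g c f p)) => //.
- exact: gram_unit.
- exact: gram_sym.
- by move=> i; exact/perp/Ke.
- by move=> i; exact/perp/Ke'.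
Qed.

End manifold.

(** * Functions with unit gradient *)

Section gradient.
Context (R : realType) (m : nat) (M : topologicalType).
Context (A : set (chart 'rV[R]_m M)) (g : chart 'rV[R]_m M -> M -> 'M[R]_m).
Hypotheses (Mman : smooth_manifold A) (gmet : semi_riemannian A g).
Implicit Types (c d : chart 'rV[R]_m M) (p q : M) (f : M -> R)
  (u w : 'rV[R]_m).

Definition gradient_square f c p : R :=
  gdot g c p (grad g c f p) (grad g c f p).

Lemma gradient_square_smooth f c k : smooth_function A f -> A c ->
  Ck k (cmap c @` cdom c) (gradient_square f c \o cinv c).
Proof.
move=> sf Ac; have oU := open_image Mman Ac.
rewrite (_ : _ \o _ = fun y => \sum_j (\sum_i grad g c f (cinv c y) 0 i *
    g c (cinv c y) i j) * grad g c f (cinv c y) 0 j); last first.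
  apply/funext => y; rewrite /= /gradient_square /gdot mxE.
  by apply: eq_bigr => j _; rewrite !mxE.
apply: Ck_sum => // j _; apply: CkM => //; last exact: (grad_smooth Mman gmet).
apply: Ck_sum => // i _; apply: CkM => //; first exact: (grad_smooth Mman gmet).
by apply: (Ck_coord oU (F := g c \o cinv c)); exact: (gram_smooth gmet).
Qed.

Lemma dif_linear c f p (a : R) u : dif c f p (a *: u) = a * dif c f p u.
Proof. by rewrite /dif linearZ. Qed.

(** Subtracting from z its component along the unit vector grad f leaves a
    vector of the kernel, which is orthogonal to u; so only that component
    contributes. *)
Lemma gdot_unit_gradient f c p (eps : R) u z : A c -> cdom c p ->
  eps = 1 \/ eps = -1 -> gradient_square f c p = eps ->
  orthogonal_complement g c p (ker_dif c f p) u ->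
  gdot g c p u z = eps * (dif c f p u * dif c f p z).
Proof.
move=> Ac cp e1 ge Hu; pose n := grad g c f p; pose a := eps * dif c f p z.
have ee : eps * eps = 1 by case: e1 => ->; rewrite ?mulrNN mulr1.
have Kz : ker_dif c f p (z - a *: n).
  have dn : dif c f p n = eps by rewrite -(gdot_grad gmet f n Ac cp).
  have -> : ker_dif c f p (z - a *: n) = (dif c f p z - a * dif c f p n = 0).
    by rewrite -dif_linear /dif -linearB.
  by rewrite dn /a mulrAC ee mul1r subrr.
rewrite -{1}(subrK (a *: n) z) [LHS](bformDr (g c p)) [X in X + _]Hu // add0r.
rewrite bformZr (bformC _ _ (gram_sym gmet Ac cp)).
by rewrite -[bform _ _ _]/(gdot g c p n u) (gdot_grad gmet) // /a; ring.
Qed.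

(** The gradient is orthogonal to the kernel of the differential and has the
    value eps under the differential, so its multiples give surjectivity; the
    remaining clauses are instances of [gdot_unit_gradient]. *)
Lemma unit_gradient_submersion f (eps : R) : smooth_function A f ->
  open_interval (range f) -> eps = 1 \/ eps = -1 ->
  (forall c p, A c -> cdom c p -> gradient_square f c p = eps) ->
  semi_riemannian_submersion A g eps f.
Proof.
move=> sf iI e1 ge.
have ee : eps * eps = 1 by case: e1 => ->; rewrite ?mulrNN mulr1.
have surj c p t : A c -> cdom c p ->
    exists2 u, orthogonal_complement g c p (ker_dif c f p) u & dif c f p u = t.
  move=> Ac cp; exists ((t * eps) *: grad g c f p).
    move=> w Kw; rewrite [LHS](bformZl (g c p)) -[bform _ _ _]/(gdot g c p _ w).
    by rewrite (gdot_grad gmet) // Kw mulr0.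
  rewrite dif_linear -(gdot_grad gmet f _ Ac cp).
  by rewrite [gdot _ _ _ _ _]ge // -mulrA ee mulr1.
split=> //.
  split=> // c p Ac cp t; have [u _ <-] := surj c p t Ac cp; by exists u.
move=> c p Ac cp /=; split; last by move=> t; exact: surj.
  move=> u Ku Hu; apply: (bform_nondegenerate (gram_unit gmet Ac cp)) => z.
  rewrite [LHS](gdot_unit_gradient z Ac cp e1 (ge c p Ac cp) Hu) Ku mul0r mulr0.
  by rewrite /bform !mul0mx mxE.
move=> u w Hu _.
by rewrite (gdot_unit_gradient w Ac cp e1 (ge c p Ac cp) Hu).
Qed.

(** For two points of a fiber choose an element of the action that maps one to
    the other, transport the frame along it, and compare the result with the
    given frame at the second point. *)
Lemma unit_gradient_cmc (S : Type) (act : S -> M -> M) f (eps : R) :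
  smooth_function A f -> eps = 1 \/ eps = -1 ->
  (forall c p, A c -> cdom c p -> gradient_square f c p = eps) ->
  (forall s, smooth_map A A (act s)) ->
  (forall s, preserves_metric A g (act s)) ->
  (forall s p, f (act s p) = f p) ->
  (forall p q, f p = f q -> exists s, act s p = q) ->
  constant_mean_curvature_fibers A g f.
Proof.
move=> sf e1 ge sact gact finv ftrans t.
pose P h := exists p c e, [/\ f p = t, A c, cdom c p,
  orthonormal_frame g c p (ker_dif c f p) e & mean_curvature g c f p e = h].
have [[h [p [c [e [fp Ac cp oe _]]]]]|noP] := pselect (exists h, P h);
  last first.
  (* No frame exists over t, so any constant will do. *)
  exists 0 => p fp c Ac cp e oe; exfalso; apply: noP.
  by exists (mean_curvature g c f p e), p, c, e.
exists (mean_curvature g c f p e) => q fq d Ad dq e' oe'.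
have [s sq] := ftrans p q (etrans fp (esym fq)).
have dp : cdom d (act s p) by rewrite sq.
rewrite -(isometry_mean_curvature Mman gmet (sact s) (gact s) sf (finv s)
  Ac Ad) //.
have := isometry_frame Mman (sact s) (gact s) sf (finv s) Ac Ad cp dp oe.
rewrite -sq in dq oe' *; move=> oe2.
apply: (mean_curvature_frame Mman gmet sf Ad dq _ oe' oe2).
have := ge d _ Ad dq; rewrite /gradient_square => ->.
exact: e1.
Qed.

Lemma grad_comp (I : set R) (v : R -> R) f c p : smooth_function A f ->
  (forall q, I (f q)) -> Ck 1 I v -> A c -> cdom c p ->
  (forall u, dif c (v \o f) p u = 'D_1 v (f p) * dif c f p u) /\
  grad g c (v \o f) p = 'D_1 v (f p) *: grad g c f p.
Proof.
move=> sf If [dv _] Ac cp.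
have [df _] := smooth_function_chart sf Ac 1%N.
have difE u : dif c (v \o f) p u = 'D_1 v (f p) * dif c f p u.
  have dfx : differentiable (f \o cinv c) (cmap c p) by apply: df; exists p.
  have dvx : differentiable v ((f \o cinv c) (cmap c p)) by exact/dv/If.
  rewrite /dif -compA (diff_comp dfx dvx) /= linear_realE mulrC.
  by rewrite -deriveE // /= (cmapK Mman).
split=> //; rewrite /grad scalemxAl; congr (_ *m _); apply/rowP => i.
by rewrite !mxE [LHS]difE.
Qed.

Lemma smooth_function_comp (I : set R) (v : R -> R) f : smooth_function A f ->
  (forall q, I (f q)) -> smooth_on I v -> smooth_function A (v \o f).
Proof.
move=> sf If Cv; split.
  move=> p; apply: continuous_comp; first exact: smooth_function_continuous sf p.
  exact: (Cv 0%N).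
move=> c _ Ac -> k; rewrite /= preimage_setT setIT.
apply: (Ck_comp (I := I) (v := v) (f := f \o cinv c)) => //.
- exact: (open_image Mman).
- by move=> y _; exact: If.
- exact: (smooth_function_chart sf Ac k).
Qed.

Lemma isometry_gradient_square phi f c d p : smooth_map A A phi ->
  preserves_metric A g phi -> smooth_function A f ->
  (forall p, f (phi p) = f p) -> A c -> A d -> cdom c p -> cdom d (phi p) ->
  gradient_square f d (phi p) = gradient_square f c p.
Proof.
move=> sphi iphi sf finv Ac Ad cp dp; rewrite /gradient_square.
rewrite (isometry_grad Mman gmet sphi iphi sf finv Ac Ad cp dp).
exact: (isometry_gdot iphi Ac Ad).
Qed.

(** A submersion maps the points of a short segment in a chart, in a direction
    where its differential is 1, onto a neighborhood of its value; [Ck_descend]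
    applies to the restriction phi of f to that segment and to the restriction
    l of the gradient square. *)
Lemma gradient_square_descends f (I : set R) (mu : R -> R) :
  smooth_function A f -> range f = I ->
  (forall c p, A c -> cdom c p -> forall t, exists u, dif c f p u = t) ->
  (forall c p, A c -> cdom c p -> mu (f p) = gradient_square f c p) ->
  smooth_on I mu.
Proof.
move=> sf fI subm muE k; apply: Ck_pointwise => t; rewrite -fI => -[p _ <-].
have [c Ac cp] := chart_at Mman p; have [u du] := subm c p Ac cp 1.
pose J1 := [set s : R | (cmap c @` cdom c) (cmap c p + s *: u)].
pose phi s := (f \o cinv c) (cmap c p + s *: u).
have Cphi j : Ck j J1 phi.
  apply: (Ck_line _ _ (f := f \o cinv c)).
  exact: (smooth_function_chart sf Ac j).
have oJ1 : open J1.
  apply: (open_comp (f := fun s : R => cmap c p + s *: u)).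
    move=> s _; apply: differentiable_continuous.
    apply: differentiableD; first exact: differentiable_cst.
    exact: differentiableZl.
  exact: (open_image Mman).
(* The derivative of phi is 1 at 0, where the segment passes through p. *)
pose J := [set s | J1 s /\ 'D_1 phi s != 0].
have oJ : open J.
  rewrite openE => s [Js phis]; rewrite /interior.
  have [_ cD] := Cphi 1%N.
  have := cD 1 s Js => /cvgr_neq0 /(_ phis) n0.
  have nJ : nbhs s J1 by exact: open_nbhs_nbhs.
  by apply: filterS2 nJ n0.
have J0 : J 0.
  split; first by exists p => //; rewrite scale0r addr0.
  have d0 : derivable (f \o cinv c) (cmap c p + 0 *: u) u.
    rewrite scale0r addr0; apply: diff_derivable.
    by have [+ _] := smooth_function_chart sf Ac 1%N; apply; exists p.
  have [_ ->] := is_derive_line d0.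
  by rewrite scale0r addr0 -(difE u sf Ac cp) du oner_neq0.
apply: (@Ck_subset _ _ _ _ _ (phi @` J)).
  by move=> _ ->; exists 0 => //; rewrite /phi scale0r addr0 /= (cmapK Mman).
pose l s := (gradient_square f c \o cinv c) (cmap c p + s *: u).
apply: (@Ck_descend _ k J phi l mu) => //.
- by move=> j; apply: Ck_subset (Cphi j) => s [].
- by move=> s [].
- move=> j; apply: (@Ck_subset _ _ _ _ _ J1); first by move=> s [].
  apply: (Ck_line _ _ (f := gradient_square f c \o cinv c)).
  exact: (gradient_square_smooth j sf Ac).
- move=> s [[q cq qE] _]; rewrite /phi /l /= -qE (cmapK Mman) //.
  exact: muE.
Qed.

End gradient.

(** * Group actions and the theorem *)

(** Slicing the smooth action map at a point s of the group. *)
Lemma smooth_action_map (R : realType) (V W : normedModType R)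
    (S : topologicalGroupCarrier) (M : topologicalType)
    (AS : set (chart V S)) (AM : set (chart W M)) (act : S -> M -> M) (s : S) :
  smooth_manifold AS -> smooth_action AS AM act -> smooth_map AM AM (act s).
Proof.
move=> Sman [_ _ [cact sact]]; split.
  move=> p; apply: (@continuous_comp _ _ _ (pair s) (fun z => act z.1 z.2)).
    by apply: cvg_pair => /=; [exact: cvg_cst|exact: cvg_id].
  exact: cact.
move=> c d Ac Ad k; have [_ _ ASc chart_at _] := Sman.
have [a Aa as_] := chart_at s; have [_ _ aK _ _] := ASc _ Aa.
have prod : prod_atlas AS AM (prod_chart a c) by exists a, c.
have := Ck_slice (cmap a s) (sact _ _ prod Ad k).
rewrite (_ : (fun y => _) = cmap d \o act s \o cinv c); last first.
  by apply/funext => y; rewrite /= aK.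
by apply: Ck_subset => _ [p [cp dp] <-]; exists (s, p).
Qed.

Theorem proposition2 (R : realType) (m k : nat)
  (M : topologicalType) (AM : set (chart 'rV[R]_m M))
  (g : chart 'rV[R]_m M -> M -> 'M[R]_m)
  (I : set R)
  (Sigma : topologicalGroupCarrier) (ASigma : set (chart 'rV[R]_k Sigma))
  (act : Sigma -> M -> M) (pi : M -> R)
  (M_manifold : smooth_manifold AM)
  (M_connected : connected [set: M])
  (g_metric : semi_riemannian AM g)
  (I_interval : open_interval I)
  (Sigma_lie : lie_group ASigma)
  (act_smooth : smooth_action ASigma AM act)
  (act_isometric : forall s, preserves_metric AM g (act s))
  (pi_submersion : submersion AM I pi)
  (fibers_orbits : forall t, I t ->
     exists p, pi @^-1` [set t] = range (fun s => act s p))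
  (grad_not_lightlike : forall c p, AM c -> cdom c p ->
     ~ lightlike g c p (grad g c pi p)) :
  exists eps : R, (eps = 1 \/ eps = -1) /\
  exists v : R -> R,
    [/\ smooth_on I v,
        semi_riemannian_submersion AM g eps (v \o pi) &
        constant_mean_curvature_fibers AM g (v \o pi)].
Proof.
have [pi_smooth pi_range pi_dif] := pi_submersion.
have [Sigma_man _ _] := Sigma_lie.
have act_map s := smooth_action_map s Sigma_man act_smooth.
have [_ actM _] := act_smooth.
have [oI iI I0] := I_interval.
have Ipi p : I (pi p) by rewrite -pi_range; exists p.
have orbit p : exists p0, (exists s, act s p0 = p) /\
    forall q, pi q = pi p <-> exists s, act s p0 = q.
  have [p0 E] := fibers_orbits _ (Ipi p).
  have fiberE q : pi q = pi p <-> exists s, act s p0 = q.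
    split=> [piq|[s sq]].
      have : (pi @^-1` [set pi p]) q by [].
      by rewrite E => -[s _ <-]; exists s.
    have : range (fun s => act s p0) q by exists s.
    by rewrite -E.
  by exists p0; split=> //; apply/fiberE.
have pi_inv s p : pi (act s p) = pi p.
  have [p0 [[s0 <-] fiberE]] := orbit p.
  by apply/fiberE; exists (s * s0)%g; rewrite actM.
have pi_trans p q : pi p = pi q -> exists s, act s p = q.
  move=> pq; have [p0 [[s0 s0p] fiberE]] := orbit p.
  have /fiberE [s1 <-] : pi q = pi p by [].
  by exists (s1 * s0^-1)%g; rewrite -s0p -actM mulgVK.
pose lambda := gradient_square g pi.
have lambda0 c p : AM c -> cdom c p -> lambda c p != 0.
  move=> Ac cp; apply/eqP => l0; apply: (grad_not_lightlike c p Ac cp).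
  split=> //; apply/eqP => n0; have [u] := pi_dif c p Ac cp 1.
  rewrite -(gdot_grad g_metric) // n0 /gdot !mul0mx mxE => /eqP.
  by rewrite eq_sym oner_eq0.
have lambda_fiber c d p q : AM c -> AM d -> cdom c p -> cdom d q ->
    pi p = pi q -> lambda c p = lambda d q.
  move=> Ac Ad cp + /pi_trans [s sq]; rewrite -sq => dq.
  by rewrite /lambda -(isometry_gradient_square M_manifold g_metric (act_map s)
    (act_isometric s) pi_smooth (pi_inv s) Ac Ad cp dq).
(* [lambda_fiber] makes the value independent of the point and the chart. *)
pose mu t := get [set r | exists c p,
  [/\ AM c, cdom c p, pi p = t & lambda c p = r]].
have muE c p : AM c -> cdom c p -> mu (pi p) = lambda c p.
  move=> Ac cp.
  have [|d [q [Ad dq piq lE]]] := @getPex _ [set r | exists c' p',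
      [/\ AM c', cdom c' p', pi p' = pi p & lambda c' p' = r]].
    by exists (lambda c p), c, p.
  by rewrite -[LHS]lE; exact: lambda_fiber.
have mu_smooth : smooth_on I mu.
  exact: (gradient_square_descends M_manifold g_metric pi_smooth).
have mu0 t : I t -> mu t != 0.
  rewrite -pi_range => -[p _ <-]; have [c Ac cp] := chart_at M_manifold p.
  by rewrite (muE c p Ac cp) lambda0.
have [eps [eps1 epsmu]] := nonvanishing_sign iI (mu_smooth 0%N) mu0.
have ee : eps * eps = 1 by case: eps1 => ->; rewrite ?mulrNN mulr1.
pose rho t := (Num.sqrt (eps * mu t))^-1.
have rho_gt0 t : I t -> 0 < rho t.
  by move=> /epsmu emu; rewrite invr_gt0 sqrtr_gt0.
(* The square of the gradient of v \o pi, for v' = rho. *)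
have rho_mu t : I t -> rho t * (rho t * mu t) = eps.
  move=> It; have emu := epsmu t It.
  have sq0 : Num.sqrt (eps * mu t) != 0 by rewrite gt_eqF // sqrtr_gt0.
  have s2 : Num.sqrt (eps * mu t) ^+ 2 = eps * mu t by rewrite sqr_sqrtr ?ltW.
  rewrite /rho; move: sq0 s2; set s := Num.sqrt _ => s0 s2.
  have -> : mu t = eps * s ^+ 2 by rewrite s2 mulrA ee mul1r.
  by field.
have rho_smooth : smooth_on I rho.
  move=> j; apply: CkV => // [t /epsmu emu|].
    by rewrite gt_eqF // sqrtr_gt0.
  apply: (Ck_comp oI (I := [set x | 0 < x]) (f := fun t => eps * mu t)) => //.
    exact: Ck_sqrt.
  by apply: CkM => //; exact: Ck_cst.
have [v vD] := antiderivative I_interval (rho_smooth 0%N).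
have v_smooth : smooth_on I v by exact: antiderivative_smooth vD rho_smooth.
have [dv _] := v_smooth 1%N.
have vE t : I t -> 'D_1 v t = rho t by move=> /vD[].
have v'0 t : I t -> 'D_1 v t != 0 by move=> It; rewrite vE // gt_eqF ?rho_gt0.
have w_smooth := smooth_function_comp M_manifold pi_smooth Ipi v_smooth.
have w_unit c p : AM c -> cdom c p -> gradient_square g (v \o pi) c p = eps.
  move=> Ac cp; rewrite /gradient_square.
  have [_ ->] := grad_comp g M_manifold pi_smooth Ipi (v_smooth 1%N) Ac cp.
  rewrite [LHS](bformZl (g c p)) bformZr -[bform _ _ _]/(lambda c p) -muE //.
  by rewrite vE // rho_mu.
exists eps; split=> //; exists v; split=> //.
  apply: unit_gradient_submersion => //.
  rewrite -(image_comp pi v) pi_range.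
  exact: open_interval_image (v_smooth 1%N) v'0.
apply: (unit_gradient_cmc M_manifold g_metric (act := act)) => //.
- exact: eps1.
- exact: w_unit.
- by move=> s p; rewrite /= pi_inv.
move=> p q vpq; apply: pi_trans.
apply: (derive_neq0_inj iI dv v'0) => //; exact: mem_set.
Qed.
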